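(* Let $n\ge2$, $\beta\in(0,2\pi)$, and let $\Omega\subset\mathbb{R}^n$ be a bounded domain contained in the infinite sector $\mathcal{A}_\beta$, with $\Gamma_1\subset\partial\Omega\cap\partial\mathcal{A}_\beta$ and $\Gamma_0=\partial\Omega\setminus\Gamma_1$. Let $c\in L^\infty(\Omega)$ satisfy $\|c^+\|_{L^\infty(\Omega)}<c_0$ for some $c_0>0$, and suppose that $w$ satisfies $$\Delta w+c(x)w\ge0\ \text{ in }\Omega,\qquad w\le0\ \text{ on }\Gamma_0,\qquad \frac{\partial w}{\partial\nu}\le0\ \text{ on }\Gamma_1,$$ where $\nu$ is the outward unit normal on $\Gamma_1$. If $$\Omega\subset\{x\in\mathbb{R}^n:\ x_{n-1}^2+x_n^2<\eta^2\},\qquad \eta=\frac{j_0}{\sqrt{c_0}},$$ where $j_0$ is the first positive zero of the Bessel function of the first kind $J_0$, then $w\le0$ in $\Omega$.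
   Context: The infinite sector of amplitude $\beta$ is $\mathcal{A}_\beta=\{x\in\mathbb{R}^n:\theta_1,\dots,\theta_{n-2}\in(0,\pi),\ \theta_{n-1}\in(0,\beta)\}$ in the usual polar coordinates $(r,\theta_1,\dots,\theta_{n-1})$ of $\mathbb{R}^n$, that is, the set of $x$ with $(x_{n-1},x_n)=(\varrho\cos\theta,\varrho\sin\theta)$ for some $\varrho>0$, $\theta\in(0,\beta)$. $c^+=\max\{c,0\}$, $w^+=\max\{w,0\}$. The system of inequalities for $w$ is understood in the weak sense: $w\in W^{1,2}(\Omega)$, $w^+\in H^1_0(\Omega\cup\Gamma_1)$, and $\int_\Omega\nabla w\cdot\nabla\phi\,dx-\int_\Omega c\,w\,\phi\,dx\le0$ for all $\phi\in H^1_0(\Omega\cup\Gamma_1)$ with $\phi\ge0$. Here $H_0^1(\Omega\cup\Gamma_1)$ is the closure in $W^{1,2}(\Omega)$ of the restrictions to $\Omega$ of functions $\varphi\in C_c^\infty(\mathbb{R}^n)$ for which $\operatorname{supp}\varphi\cap\overline{\Omega}$ is a compact subset of $\Omega\cup\Gamma_1$. *)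

(* Defs.v *)
From HB Require Import structures.
From mathcomp Require Import all_boot all_order all_algebra.
From mathcomp Require Import all_classical all_reals all_analysis.

Set Implicit Arguments.
Unset Strict Implicit.
Unset Printing Implicit Defensive.

Import Order.TTheory GRing.Theory Num.Theory.
Import numFieldNormedType.Exports.

Local Open Scope classical_set_scope.
Local Open Scope ring_scope.

(* R^n is ['rV[R]_n]. The norm of ['rV[R]_n] in the library is the sup norm;
   it is only used through the topology and boundedness.
   The sigma-algebra is generated by the coordinates (as the library does for
   [n.-tuple T]), i.e., it is the Borel sigma-algebra of R^n. *)
Section measurable_rV.
Context {R : realType}.
Variable n : nat.

Definition coord_rV (i : 'I_n) (x : 'rV[R]_n) : measurableTypeR R := x ord0 i.

Let rV_set0 : g_sigma_preimage coord_rV set0.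
Proof. exact: sigma_algebra0. Qed.

Let rV_setC A : g_sigma_preimage coord_rV A -> g_sigma_preimage coord_rV (~` A).
Proof. exact: sigma_algebraC. Qed.

Let rV_bigcup (F : _^nat) : (forall i, g_sigma_preimage coord_rV (F i)) ->
  g_sigma_preimage coord_rV (\bigcup_i (F i)).
Proof. exact: sigma_algebra_bigcup. Qed.

HB.instance Definition _ := @isMeasurable.Build
  (measure_tuple_display default_measure_display)
  'rV[R]_n (g_sigma_preimage coord_rV) rV_set0 rV_setC rV_bigcup.

End measurable_rV.

Lemma measurable_coord_rV (R : realType) n (i : 'I_n) :
  measurable_fun [set: 'rV[R]_n] (coord_rV i).
Proof.
move=> _ C mC; rewrite setTI; apply: sub_sigma_algebra.
rewrite -bigcup_seq; exists i => /=; first by rewrite mem_index_enum.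
by exists C => //; rewrite setTI.
Qed.

Lemma measurable_fun_rV d (T : measurableType d) (R : realType) n
    (f : T -> 'rV[R]_n) :
  (forall i, measurable_fun [set: T] (coord_rV i \o f)) ->
  measurable_fun [set: T] f.
Proof.
move=> mf _; set G := [set B : set 'rV[R]_n | measurable (f @^-1` B)].
suff GP : (@measurable _ 'rV[R]_n) `<=` G by move=> B mB; rewrite setTI; exact: GP.
apply: smallest_sub.
  split; rewrite /G /=.
  - by rewrite preimage_set0; exact: measurable0.
  - by move=> A mA; rewrite setTD preimage_setC; exact: measurableC.
  - by move=> F mF; rewrite preimage_bigcup; exact: bigcup_measurable.
move=> B; rewrite -bigcup_seq => -[/= i _ [A mA <-]].
by rewrite /G /= setTI -comp_preimage -[X in measurable X]setTI; exact: mf.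
Qed.

Section lebesgue_rV_step.
Context {R : realType}.
Variable n : nat.

Definition cons_rV (p : measurableTypeR R * 'rV[R]_n) : 'rV[R]_n.+1 :=
  row_mx (const_mx p.1 : 'rV[R]_1) p.2.

Let uncons_rV (v : 'rV[R]_n.+1) : measurableTypeR R * 'rV[R]_n :=
  (v ord0 ord0, \row_j v ord0 (lift ord0 j)).

Let cons_rV0 p : cons_rV p ord0 ord0 = p.1.
Proof.
rewrite (_ : ord0 = lshift n (ord0 : 'I_1)); last exact/val_inj.
by rewrite (row_mxEl (const_mx p.1 : 'rV[R]_1)) mxE.
Qed.

Let cons_rVS p j : cons_rV p ord0 (lift ord0 j) = p.2 ord0 j.
Proof.
rewrite (_ : lift ord0 j = rshift 1 j); last exact/val_inj.
by rewrite (row_mxEr (const_mx p.1 : 'rV[R]_1)).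
Qed.

Let measurable_cons_rV : measurable_fun [set: _] cons_rV.
Proof.
apply: measurable_fun_rV => i; case: (unliftP ord0 i) => [j|] ->.
  rewrite (_ : _ \o _ = coord_rV j \o snd); last first.
    by apply/funext => p /=; rewrite /coord_rV cons_rVS.
  apply: measurableT_comp; first exact: measurable_coord_rV.
  exact: measurable_snd.
rewrite (_ : _ \o _ = fst); first exact: measurable_fst.
by apply/funext => p /=; rewrite /coord_rV cons_rV0.
Qed.

HB.instance Definition _ :=
  isMeasurableFun.Build _ _ _ _ cons_rV measurable_cons_rV.

Let measurable_uncons_rV : measurable_fun [set: _] uncons_rV.
Proof.
apply/measurable_fun_pairP; split; first exact: (@measurable_coord_rV R n.+1 ord0).
apply: measurable_fun_rV => j.
rewrite (_ : _ \o _ = coord_rV (lift ord0 j)); first exact: measurable_coord_rV.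
by apply/funext => v /=; rewrite /coord_rV mxE.
Qed.

Let cons_rVK : cancel cons_rV uncons_rV.
Proof.
move=> [x v]; rewrite /uncons_rV cons_rV0; congr (_, _).
by apply/rowP => j; rewrite mxE cons_rVS.
Qed.

Variable m : {sigma_finite_measure set 'rV[R]_n -> \bar R}.

Definition lebesgue_cons_rV : set 'rV[R]_n.+1 -> \bar R :=
  pushforward (lebesgue_measure \x m)%E cons_rV.

Let leb0 : lebesgue_cons_rV set0 = 0%E.
Proof. exact: measure0. Qed.

Let leb_ge0 A : (0 <= lebesgue_cons_rV A)%E.
Proof. exact: measure_ge0. Qed.

Let leb_sigma_additive : semi_sigma_additive lebesgue_cons_rV.
Proof. exact: measure_semi_sigma_additive. Qed.

HB.instance Definition _ := isMeasure.Build _ _ _ lebesgue_cons_rV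
  leb0 leb_ge0 leb_sigma_additive.

Let leb_sigma_finite : sigma_finite setT lebesgue_cons_rV.
Proof.
have /sigma_finiteP[F [FT ndF Foo]] := sigma_finiteT (@lebesgue_measure R).
have /sigma_finiteP[G [GT ndG Goo]] := sigma_finiteT m.
exists (fun k => uncons_rV @^-1` (F k `*` G k)).
  apply/esym/seteqP; split=> // v _.
  have [a _ Fa] : (\bigcup_i F i) (v ord0 ord0) by rewrite -FT.
  have [b _ Gb] : (\bigcup_i G i) (uncons_rV v).2 by rewrite -GT.
  exists (maxn a b) => //; split => /=.
    by move: Fa; apply/subsetPset/ndF/leq_maxl.
  by move: Gb; apply/subsetPset/ndG/leq_maxr.
move=> k; have [mF Fk] := Foo k; have [mG Gk] := Goo k; split.
  rewrite -[X in measurable X]setTI; apply: measurable_uncons_rV => //.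
  exact: measurableX.
rewrite /lebesgue_cons_rV /pushforward -comp_preimage.
rewrite (_ : _ \o _ = id); last exact/funext/cons_rVK.
by rewrite preimage_id product_measure1E// lte_mul_pinfty// ge0_fin_numE.
Qed.

HB.instance Definition _ := Measure_isSigmaFinite.Build _ _ _ lebesgue_cons_rV
  leb_sigma_finite.

End lebesgue_rV_step.

(* n-dimensional Lebesgue measure (on Borel sets) as an iterated product *)
Fixpoint lebesgue_rV (R : realType) n :
    {sigma_finite_measure set 'rV[R]_n -> \bar R} :=
  match n with
  | 0 => \d_(0 : 'rV[R]_0)
  | k.+1 => lebesgue_cons_rV (lebesgue_rV R k)
  end.

Section smooth.
Context {R : realType} {n : nat}.
Implicit Types (f : 'rV[R]_n -> R) (A : set 'rV[R]_n).

Definition pderiv (i : 'I_n) f : 'rV[R]_n -> R :=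
  fun x => 'D_(delta_mx ord0 i) f x.

Definition smooth f := forall s : seq 'I_n,
  continuous (foldr pderiv f s) /\
  forall (i : 'I_n) x, derivable (foldr pderiv f s) x (delta_mx ord0 i).

Definition supp f : set 'rV[R]_n := closure [set x | f x != 0].

(* C_c^oo(A) for an open set A *)
Definition Ccoo A : set ('rV[R]_n -> R) :=
  [set f | [/\ smooth f, compact (supp f) & supp f `<=` A]].

Definition frontier A : set 'rV[R]_n := closure A `\` interior A.

Definition bounded_domain A :=
  [/\ A !=set0, open A, connected A & bounded_set A].

End smooth.

(* Function spaces over an open set [Omega]. An element is represented by a
   Borel function on R^n; only its values on [Omega], up to a Lebesgue-null
   set, matter. *)
Section sobolev.
Context {R : realType} {n : nat}.
Variable Omega : set 'rV[R]_n.
Local Notation mu := (lebesgue_rV R n).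
Implicit Types (u v w c : 'rV[R]_n -> R) (Gamma : set 'rV[R]_n).

Definition Lp (p : \bar R) : set ('rV[R]_n -> R) :=
  [set u | u \_ Omega \in Lfun mu p].

Definition is_wpderiv (i : 'I_n) u v := forall phi, Ccoo Omega phi ->
  \int[mu]_(x in Omega) (u x * pderiv i phi x) =
  - \int[mu]_(x in Omega) (v x * phi x).

Definition W12 : set ('rV[R]_n -> R) :=
  [set u | Lp 2%:E u /\ forall i, exists2 v, Lp 2%:E v & is_wpderiv i u v].

(* a representative of the i-th weak partial derivative of u in W^{1,2}(Omega);
   junk (the zero function) if there is none in L^2(Omega) *)
Definition wpderiv (i : 'I_n) u : 'rV[R]_n -> R :=
  xget (cst 0) [set v | Lp 2%:E v /\ is_wpderiv i u v].

Definition W12norm u : \bar R :=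
  ((\int[mu]_(x in Omega)
      (u x ^+ 2 + \sum_(i < n) wpderiv i u x ^+ 2)%R%:E) `^ 2^-1)%E.

(* H^1_0(Omega `|` Gamma): the closure in W^{1,2}(Omega) of the restrictions to
   Omega of the C_c^oo(R^n) functions whose support meets the closure of Omega
   in a compact subset of Omega `|` Gamma *)
Definition H10 Gamma : set ('rV[R]_n -> R) :=
  [set u | W12 u /\ forall e : R, 0 < e -> exists phi,
    [/\ Ccoo setT phi,
        compact (supp phi `&` closure Omega),
        supp phi `&` closure Omega `<=` Omega `|` Gamma &
        (W12norm (u \- phi)%R < e%:E)%E]].

(* weak form of: Laplacian w + c w >= 0 in Omega, w <= 0 on the part
   Gamma_0 = frontier Omega `\` Gamma of the boundary, and dw/dnu <= 0 on
   Gamma. The condition on Gamma_0 is w^+ \in H^1_0(Omega `|` Gamma); the one on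
   Gamma is carried by the test functions not vanishing there. *)
Definition weak_mixed_subsolution Gamma c w :=
  [/\ W12 w, H10 Gamma w^\+ &
    forall phi, H10 Gamma phi ->
      {ae mu, forall x, Omega x -> 0 <= phi x} ->
      (\int[mu]_(x in Omega) (\sum_(i < n) wpderiv i w x * wpderiv i phi x))
      - (\int[mu]_(x in Omega) (c x * w x * phi x)) <= 0].

End sobolev.

(* In R^(n+2), the last two coordinates are those of index n and n + 1. *)
Section sector.
Context {R : realType} {n : nat}.

Definition penult_coord (x : 'rV[R]_n.+2) : R := x ord0 (inord n).
Definition last_coord (x : 'rV[R]_n.+2) : R := x ord0 ord_max.

Definition sector (beta : R) : set 'rV[R]_n.+2 :=
  [set x | exists rho theta : R,
    [/\ 0 < rho, 0 < theta < beta,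
        penult_coord x = rho * cos theta & last_coord x = rho * sin theta]].

End sector.

(* Bessel function of the first kind of order m, a power series with infinite
   radius of convergence *)
Definition besselJ {R : realType} (m : nat) (x : R) : R :=
  limn (series (fun k => (-1) ^+ k / (k`! * (k + m)`!)%N%:R
                         * (x / 2) ^+ (2 * k + m)%N)).

(* J_0 has positive zeros and J_0(0) = 1, so the infimum is attained. *)
Definition bessel_j0 {R : realType} : R :=
  inf [set x | 0 < x /\ besselJ 0 x = 0].

(* Main.v *)
Require Import Defs.
From HB Require Import structures.
From mathcomp Require Import all_boot all_order all_algebra.
From mathcomp Require Import all_classical all_reals all_analysis.
From mathcomp Require Import measurable_realfun ess_sup_inf ring lra.

Import Order.TTheory GRing.Theory Num.Theory.
Import numFieldNormedType.Exports.

Local Open Scope classical_set_scope.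
Local Open Scope ring_scope.

(** Write x' for the last two coordinates, s = |x'|^2 and u = w^+. Let C be the
    essential supremum of c^+ and C < c_1 < c_0. Testing the inequality with u
    gives: integral of |grad u|^2 <= C times the integral of u^2 ([energy_le]).
    A Poincare inequality with constant c_1 holds on H^1_0 ([poincare_test],
    [poincare_H10]), so the integral of u^2 is nonpositive and u = 0.

    For the Poincare inequality, psi = J_0(sqrt c_1 |x'|) is positive on the
    closed cylinder, because c_1 < c_0, and satisfies Laplacian psi = - c_1 psi.
    Expanding |grad phi - phi grad psi / psi|^2 >= 0 for a test function phi
    gives |grad phi|^2 >= c_1 phi^2 + div (phi^2 grad psi / psi). The field
    grad psi / psi = 2 k(s) x' is tangent to the faces of the sector, so the
    divergence integrates to zero whatever phi does on Gamma_1. No regularity of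
    Omega is available, so this is proved through dilations rather than by a
    divergence theorem: with g = phi^2 k(s) on Omega and 0 elsewhere,
    div (g x') is the derivative at t = 1 of t^2 g(t x', y), whose integral does
    not depend on t ([Rintegral_aff], [Rintegral_derive_cst]). Each function
    t |-> g(t x', y) is differentiable since the sector is an open cone and phi
    vanishes near the part of the boundary of Omega interior to it
    ([test_extends_by_zero]). In terms of k the equation of psi is the Riccati
    equation of [bessel_riccati].

    The energy inequality requires grad w . grad u = |grad u|^2 almost
    everywhere. Only u, not w, comes with smooth approximants. Through them two
    identities pass to the limit: the Leibniz rule for products v u with v in
    W^{1,2} ([weak_leibniz]) and the chain rule for truncations of u
    ([weak_trunc]). The second one yields grad u = 0 on {u = 0}
    ([wpderiv_eq0_on_zero_set]); the first one, applied to v = w and to v = u,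
    yields grad w = grad u on {u <> 0} because w u = u^2
    ([wpderiv_mul_funrpos]). All this identifies functions from their integrals
    against test functions, which is the role of [fundamental_lemma]. *)

Set Implicit Arguments.
Unset Strict Implicit.

(** * Boxes and Borel sets of R^n *)

Section boxes.
Context {R : realType} {n : nat}.
Implicit Types (a b : 'I_n -> R) (x : 'rV[R]_n).

Definition obox a b : set 'rV[R]_n := [set x | forall i, a i < x ord0 i < b i].
Definition cbox a b : set 'rV[R]_n := [set x | forall i, a i <= x ord0 i <= b i].

Lemma obox_sub_cbox a b : obox a b `<=` cbox a b.
Proof. by move=> x xab i; have /andP[/ltW -> /ltW ->] := xab i. Qed.

Lemma setI_obox a b a' b' :
  obox a b `&` obox a' b' =
  obox (fun i => Num.max (a i) (a' i)) (fun i => Num.min (b i) (b' i)).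
Proof.
apply/seteqP; split=> x.
  by move=> [h h'] i; rewrite gt_max lt_min; have /andP[-> ->] := h i;
    have /andP[-> ->] := h' i.
move=> h; split=> i; have := h i; rewrite gt_max lt_min.
  by move=> /andP[/andP[-> _] /andP[-> _]].
by move=> /andP[/andP[_ ->] /andP[_ ->]].
Qed.

Lemma obox_preimage a b :
  obox a b = \bigcap_i (coord_rV i @^-1` (`]a i, b i[%classic : set R)).
Proof.
apply/seteqP; split=> x.
  by move=> h i _ /=; rewrite in_itv/=; exact: h.
by move=> h i; have := h i I; rewrite /= in_itv.
Qed.

Lemma measurable_obox a b : measurable (obox a b).
Proof.
rewrite obox_preimage; case: n a b => [|m] a b.
  by rewrite (_ : \bigcap_i _ = setT)//; apply/seteqP; split=> // x _ -[].
apply: fin_bigcap_measurable; [exact: finite_finset|move=> i _].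
by rewrite -[X in measurable X]setTI; exact: measurable_coord_rV.
Qed.

Lemma measurable_cbox a b : measurable (cbox a b).
Proof.
have -> : cbox a b = \bigcap_i (coord_rV i @^-1` (`[a i, b i]%classic : set R)).
  apply/seteqP; split=> x.
    by move=> h i _ /=; rewrite in_itv/=; exact: h.
  by move=> h i; have := h i I; rewrite /= in_itv.
case: n a b => [|m] a b.
  by rewrite (_ : \bigcap_i _ = setT)//; apply/seteqP; split=> // x _ -[].
apply: fin_bigcap_measurable; [exact: finite_finset|move=> i _].
by rewrite -[X in measurable X]setTI; exact: measurable_coord_rV.
Qed.

(** Rational boxes are countably many: they make open sets Borel and turn local
    almost-everywhere statements into global ones. *)
Lemma open_rat_box (A : set 'rV[R]_n) x : open A -> A x ->
  exists p : 'rV[rat]_n * 'rV[rat]_n,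
    obox (fun i => ratr (p.1 ord0 i)) (fun i => ratr (p.2 ord0 i)) x /\
    cbox (fun i => ratr (p.1 ord0 i)) (fun i => ratr (p.2 ord0 i)) `<=` A.
Proof.
move=> oA Ax; have /nbhs_ballP[e /= e0 eA] := open_nbhs_nbhs (conj oA Ax).
have lo i : {q : rat | x ord0 i - e < ratr q < x ord0 i}.
  apply: cid; have /rat_in_itvoo[q] : x ord0 i - e < x ord0 i by rewrite ltrBlDr ltrDl.
  by rewrite in_itv /= => h; exists q.
have hi i : {q : rat | x ord0 i < ratr q < x ord0 i + e}.
  apply: cid; have /rat_in_itvoo[q] : x ord0 i < x ord0 i + e by rewrite ltrDl.
  by rewrite in_itv /= => h; exists q.
exists (\row_i sval (lo i), \row_i sval (hi i)); split=> [i|y yab].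
  rewrite /= !mxE; have /andP[_ ->] := svalP (lo i).
  by have /andP[-> _] := svalP (hi i).
apply: eA; split=> // k i; rewrite (ord1 k).
have := yab i; rewrite /= !mxE => /andP[h1 h2].
have /andP[h3 _] := svalP (lo i); have /andP[_ h4] := svalP (hi i).
by rewrite /ball /= ltr_norml; apply/andP; split; lra.
Qed.

Lemma open_measurable_rV (A : set 'rV[R]_n) : open A -> measurable A.
Proof.
move=> oA; pose B (p : 'rV[rat]_n * 'rV[rat]_n) : set 'rV[R]_n :=
  obox (fun i => ratr (p.1 ord0 i)) (fun i => ratr (p.2 ord0 i)).
have -> : A = \bigcup_(p in [set p | B p `<=` A]) B p.
  apply/seteqP; split=> [x Ax|x [p /= BA Bx]]; last exact: BA.
  have [p [px pA]] := open_rat_box oA Ax; exists p => //=.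
  exact: subset_trans (@obox_sub_cbox _ _) pA.
rewrite bigcup_mkcond; apply: countable_bigcupT_measurable => // p.
by case: ifP => // _; exact: measurable_obox.
Qed.

Lemma continuous_measurable_rV (f : 'rV[R]_n -> R) (D : set 'rV[R]_n) :
  continuous f -> measurable_fun D f.
Proof.
move=> cf; apply: (@measurable_funS _ _ _ _ setT) => //.
apply: (measurability _ (RGenOpens.measurableE R)) => //.
move=> _ [_ [x [y ->]] <-]; rewrite setTI; apply: open_measurable_rV.
by apply: open_comp => // z _; exact: cf.
Qed.

Lemma bounded_box (A : set 'rV[R]_n) : bounded_set A ->
  exists2 M : R, 0 < M & A `<=` cbox (fun=> - M) (fun=> M).
Proof.
move=> [M [_ hM]]; exists (`|M| + 1); first by rewrite ltr_wpDl.
move=> x Ax i; have /= := hM (`|M| + 1) _ x Ax.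
rewrite (le_lt_trans (ler_norm M)) ?ltrDl// => /(_ isT) xM.
rewrite -ler_norml; apply: le_trans xM.
rewrite {2}/Num.norm /= mx_normrE.
exact: (@le_bigmax _ _ _ _ (fun i => `|x i.1 i.2|) (ord0, i)).
Qed.

End boxes.

(** * Lebesgue measure under diagonal affine maps *)

Section affine.
Context {R : realType}.

Definition aff n (a b : 'I_n -> R) (x : 'rV[R]_n) : 'rV[R]_n :=
  \row_i (a i * x ord0 i + b i).

Lemma measurable_aff n (a b : 'I_n -> R) : measurable_fun [set: 'rV[R]_n] (aff a b).
Proof.
apply: measurable_fun_rV => i.
rewrite (_ : _ \o _ = fun x => a i * coord_rV i x + b i); last first.
  by apply/funext => x; rewrite /= /coord_rV !mxE.
apply: measurable_funD => //; apply: measurable_funM => //.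
exact: measurable_coord_rV.
Qed.

Definition aff1 (a b : R) (x : measurableTypeR R) : measurableTypeR R := a * x + b.

Lemma measurable_aff1 a b : measurable_fun setT (aff1 a b).
Proof. by apply: measurable_funD => //; exact: measurable_funM. Qed.

HB.instance Definition _ a b :=
  isMeasurableFun.Build _ _ _ _ (aff1 a b) (measurable_aff1 a b).

Lemma lebesgue_aff1 (a b : R) (A : set (measurableTypeR R)) : 0 < a -> measurable A ->
  (a%:E * lebesgue_measure (aff1 a b @^-1` A) = lebesgue_measure A)%E.
Proof.
move=> a0 mA; apply/esym.
rewrite (lebesgue_measure_unique (mu := mscale (NngNum (ltW a0))
  (pushforward lebesgue_measure (aff1 a b))))//.
move=> _ [[u v]] _ <-; rewrite /= /mscale/= /pushforward.
have -> : aff1 a b @^-1` `]u, v]%classic = `](u - b) / a, (v - b) / a]%classic.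
  apply/seteqP; split=> x; rewrite /= !in_itv/= /aff1 ltr_pdivrMr// ler_pdivlMr//.
    by rewrite ltrBlDr lerBrDr mulrC.
  by rewrite ltrBlDr lerBrDr mulrC.
rewrite !lebesgue_measure_itv/= !lte_fin ltr_pM2r ?invr_gt0// ltrD2r.
case: ifPn => // _; last by rewrite mule0.
by rewrite -!EFinB -EFinM; congr EFin; field; rewrite gt_eqF.
Qed.

Lemma lebesgue_rVS n (A : set 'rV[R]_n.+1) :
  lebesgue_rV R n.+1 A = (lebesgue_measure \x lebesgue_rV R n)%E (@cons_rV R n @^-1` A).
Proof. by []. Qed.

Lemma cons_rV_ord0 n (p : measurableTypeR R * 'rV[R]_n) : cons_rV p ord0 ord0 = p.1.
Proof.
rewrite (_ : ord0 = lshift n (ord0 : 'I_1)); last exact/val_inj.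
by rewrite (row_mxEl (const_mx p.1 : 'rV[R]_1)) mxE.
Qed.

Lemma cons_rV_lift n (p : measurableTypeR R * 'rV[R]_n) j :
  cons_rV p ord0 (lift ord0 j) = p.2 ord0 j.
Proof.
rewrite (_ : lift ord0 j = rshift 1 j); last exact/val_inj.
by rewrite (row_mxEr (const_mx p.1 : 'rV[R]_1)).
Qed.

Lemma measurable_cons_rV n : measurable_fun setT (@cons_rV R n).
Proof. exact: measurable_funPT. Qed.

(** Product measures reduce this to the line, where two measures agree as soon as
    they agree on intervals. *)
Lemma lebesgue_aff n (a b : 'I_n -> R) (A : set 'rV[R]_n) :
  (forall i, 0 < a i) -> measurable A ->
  ((\prod_i a i)%:E * lebesgue_rV R n (aff a b @^-1` A) = lebesgue_rV R n A)%E.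
Proof.
elim: n a b A => [|n IH] a b A a0 mA.
  rewrite big_ord0 mul1e; congr (lebesgue_rV R 0 _).
  by apply/seteqP; split=> x; rewrite /= (_ : aff a b x = x)//; apply/rowP => -[].
pose a' i := a (lift ord0 i); pose b' i := b (lift ord0 i).
pose aff2 (p : measurableTypeR R * 'rV[R]_n) : measurableTypeR R * 'rV[R]_n :=
  (aff1 (a ord0) (b ord0) p.1, aff a' b' p.2).
have maff2 : measurable_fun setT aff2.
  apply/measurable_fun_pairP; split.
    exact: measurableT_comp (measurable_aff1 _ _) measurable_fst.
  exact: measurableT_comp (measurable_aff _ _) measurable_snd.
have cE : aff a b \o @cons_rV R n = @cons_rV R n \o aff2.
  apply/funext => p; apply/rowP => i; rewrite /comp [LHS]mxE.
  case: (unliftP ord0 i) => [j|] ->.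
    by rewrite -!/(cons_rV _) !cons_rV_lift !mxE.
  by rewrite -!/(cons_rV _) !cons_rV_ord0.
have P0 : 0 < \prod_i a i by apply: prodr_gt0.
rewrite !lebesgue_rVS -comp_preimage cE comp_preimage.
have mB : measurable (@cons_rV R n @^-1` A).
  by rewrite -[X in measurable X]setTI; exact: measurable_cons_rV.
move: (_ @^-1` A) mB => B mB.
apply/esym; pose aff2M : {mfun _ >-> _} := HB.pack aff2 (isMeasurableFun.Build _ _ _ _ _ maff2).
rewrite (product_measure_unique (m' := mscale (NngNum (ltW P0))
  (pushforward (lebesgue_measure \x lebesgue_rV R n)%E aff2M)))// => U V mU mV.
rewrite /= /mscale/= /pushforward.
have -> : aff2 @^-1` (U `*` V) = (aff1 (a ord0) (b ord0) @^-1` U) `*` (aff a' b' @^-1` V).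
  by apply/seteqP; split.
rewrite product_measure1E; last 2 first.
- by rewrite -[X in measurable X]setTI; exact: measurable_aff1.
- by rewrite -[X in measurable X]setTI; exact: measurable_aff.
rewrite big_ord_recl/= EFinM muleACA lebesgue_aff1//.
by congr (_ * _)%E; exact: IH.
Qed.

Lemma lebesgue_cbox_lty n (a b : 'I_n -> R) : (lebesgue_rV R n (cbox a b) < +oo)%E.
Proof.
elim: n a b => [|n IH] a b.
  rewrite (_ : cbox a b = setT); first by rewrite /= diracE in_setT ltry.
  by apply/seteqP; split=> // x _ -[].
rewrite lebesgue_rVS.
rewrite (_ : _ @^-1` _ = `[a ord0, b ord0]%classic `*`
   cbox (fun i => a (lift ord0 i)) (fun i => b (lift ord0 i))); last first.
  apply/seteqP; split=> [p h|p [/= h1 h2] i].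
    split=> /=; first by have := h ord0; rewrite in_itv/= cons_rV_ord0.
    by move=> i; have := h (lift ord0 i); rewrite cons_rV_lift.
  case: (unliftP ord0 i) => [j|] ->; first by rewrite cons_rV_lift; exact: h2.
  by move: h1; rewrite cons_rV_ord0 in_itv.
rewrite product_measure1E//; last exact: measurable_cbox.
rewrite lte_mul_pinfty//.
  rewrite ge0_fin_numE//= (lebesgue_measure_itv `[a ord0, b ord0]) /=.
  by case: ifP; rewrite ?ltry.  
Qed.

Lemma bounded_lebesgue_lty n (A : set 'rV[R]_n) : measurable A -> bounded_set A ->
  (lebesgue_rV R n A < +oo)%E.
Proof.
move=> mA /bounded_box[M _ AM].
apply: le_lt_trans (lebesgue_cbox_lty (fun=> - M) (fun=> M)).
by apply: le_measure; rewrite ?inE//; exact: measurable_cbox.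
Qed.

Lemma ge0_integral_aff n (a b : 'I_n -> R) (g : 'rV[R]_n -> \bar R) :
  (forall i, 0 < a i) -> measurable_fun setT g -> (forall x, 0 <= g x)%E ->
  ((\prod_i a i)%:E * \int[lebesgue_rV R n]_x g (aff a b x)
   = \int[lebesgue_rV R n]_x g x)%E.
Proof.
move=> a0 mg g0; have P0 : 0 < \prod_i a i by apply: prodr_gt0.
pose m : {measure set _ -> \bar R} := mscale (NngNum (ltW P0)) (pushforward (lebesgue_rV R n) (aff a b)).
transitivity (\int[m (measurable_aff a b)]_x g x)%E; last first.
  by apply: eq_measure_integral => A mA _; exact: lebesgue_aff.
rewrite ge0_integral_mscale//=; congr (_ * _)%E.
by rewrite ge0_integral_pushforward//; exact: measurable_aff.
Qed.

Lemma Rintegral_aff n (a b : 'I_n -> R) (g : 'rV[R]_n -> R) :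
  (forall i, 0 < a i) ->
  (lebesgue_rV R n).-integrable setT (EFin \o g) ->
  (lebesgue_rV R n).-integrable setT (EFin \o (g \o aff a b)) /\
  (\prod_i a i) * \int[lebesgue_rV R n]_x g (aff a b x)
   = \int[lebesgue_rV R n]_x g x.
Proof.
move=> a0 ig; have P0 : 0 < \prod_i a i by apply: prodr_gt0.
have /integrableP[/measurable_EFinP mg foo] := ig.
have ig' : (lebesgue_rV R n).-integrable setT (EFin \o (g \o aff a b)).
  apply/integrableP; split.
    by apply/measurable_EFinP; apply: measurableT_comp => //; exact: measurable_aff.
  move: foo; rewrite -(ge0_integral_aff b a0)//; last first.
    by apply: measurableT_comp => //; exact/measurable_EFinP.
  rewrite ltNge leye_eq => /eqP foo; rewrite ltNge leye_eq.
  by apply/negP => /eqP E; apply: foo; rewrite [X in (_ * X)%E]E gt0_muley// lte_fin.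
split=> //.
have E (f : 'rV[R]_n -> \bar R) : measurable_fun setT f -> (forall x, 0 <= f x)%E ->
    (\int[lebesgue_rV R n]_x f (aff a b x) < +oo)%E ->
    (\prod_i a i) * fine (\int[lebesgue_rV R n]_x f (aff a b x))%E
    = fine (\int[lebesgue_rV R n]_x f x)%E.
  move=> mf f0 fin; rewrite -(ge0_integral_aff b a0 mf f0) fineM//.
  by rewrite ge0_fin_numE//; apply: integral_ge0.
have mG : measurable_fun setT (EFin \o g) by exact/measurable_EFinP.
rewrite /Rintegral (integralE _ _ (EFin \o (g \o aff a b))) (integralE _ _ (EFin \o g)).
rewrite [X in _ * X]fineB; [rewrite [RHS]fineB|..].
- have := integral_funepos_lt_pinfty measurableT ig'; rewrite (funepos_comp (EFin \o g)) => fp.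
  have := integral_funeneg_lt_pinfty measurableT ig'; rewrite (funeneg_comp (EFin \o g)) => fm.
  rewrite mulrBr -(E _ (measurable_funepos mG) _ fp)//.
  by rewrite -(E _ (measurable_funeneg mG) _ fm).
- exact: integrable_pos_fin_num.
- exact: integrable_neg_fin_num.
- exact: integrable_pos_fin_num.
- exact: integrable_neg_fin_num.
Qed.

End affine.

(** * Directional derivatives *)

Section directional.
Context {R : realType} {n : nat}.
Implicit Types (f g : 'rV[R]_n -> R) (x u v : 'rV[R]_n).

Lemma is_derive_of_cvg (V : normedModType R) (f : V -> R) (x v : V) (d : R) :
  h^-1 *: (f (h *: v + x) - f x) @[h --> 0^'] --> d -> is_derive x v f d.
Proof.
move=> fd; apply: DeriveDef; first by apply/cvg_ex; exists d.
exact: cvg_lim.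
Qed.

Lemma cvg_of_is_derive (V : normedModType R) (f : V -> R) (x v : V) (d : R) :
  is_derive x v f d -> h^-1 *: (f (h *: v + x) - f x) @[h --> 0^'] --> d.
Proof. by move=> [/cvgP + <-]; exact. Qed.

Lemma is_derive_line f x v (t d : R) :
  is_derive t 1 (fun s : R => f (x + s *: v)) d <-> is_derive (x + t *: v) v f d.
Proof.
have E : (fun h : R => h^-1 *: (f (h *: v + (x + t *: v)) - f (x + t *: v))) =
    (fun h : R => h^-1 *: ((fun s : R => f (x + s *: v)) (h *: 1 + t)
                 - (fun s : R => f (x + s *: v)) t)).
  by apply/funext => h /=; rewrite [_%:A]mulr1 scalerDl addrCA.
split=> /cvg_of_is_derive; first by rewrite -E => H; exact: is_derive_of_cvg.
by rewrite E => H; exact: is_derive_of_cvg.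
Qed.

Lemma is_derive_line0 f x v (d : R) :
  is_derive (0 : R) 1 (fun s : R => f (x + s *: v)) d <-> is_derive x v f d.
Proof. by rewrite is_derive_line scale0r addr0. Qed.

Lemma is_derive_dirZ f x v (a d : R) :
  is_derive x v f d -> is_derive x (a *: v) f (a * d).
Proof.
move=> /is_derive_line0 H; apply/is_derive_line0.
rewrite (_ : (fun s : R => _) = (fun s : R => f (x + s *: v)) \o (fun s : R => s * a)).
  rewrite mulrC; apply: is_derive1_comp.
    by rewrite mul0r.
  apply: is_derive_eq.
  by rewrite [LHS]/= scaler0 add0r [LHS]mulr1.
by apply/funext => s; rewrite /= scalerA.
Qed.

(** Only the increment along [v] starts from a moving base point. It is a mean
    value of the derivative along [v], whose continuity gives the limit. *)
Lemma is_derive_dirD f x u v :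
  derivable f x u -> (forall y, derivable f y v) -> continuous ('D_v f) ->
  is_derive x (u + v) f ('D_u f x + 'D_v f x).
Proof.
move=> du dv cv; apply: is_derive_of_cvg.
rewrite (_ : (fun h : R => _) = (fun h : R => h^-1 *: (f (h *: u + x) - f x)
    + h^-1 *: (f (h *: v + (h *: u + x)) - f (h *: u + x)))); last first.
  apply/funext => h; rewrite -scalerDr; congr (_ *: _).
  have -> : h *: (u + v) + x = h *: v + (h *: u + x).
    by rewrite scalerDr addrA [h *: v + _]addrC.
  ring.
apply: cvgD; first exact: cvg_of_is_derive (derivableP du).
apply/cvgrPdist_le => e e0.
have /cvgrPdist_le/(_ _ e0) := cv x; rewrite -nbhs_nearE => /nbhs_ballP[d /= d0 xd].
pose M := `|u| + `|v| + 1; have M0 : 0 < M by rewrite ltr_wpDl.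
have hM : \forall h \near (0 : R), `|h| < d / M by apply: nbhs0_lt; exact: divr_gt0.
rewrite near_withinE; near=> h => h0.
have [c [ch ->]] : exists c : R, `|c| <= `|h| /\
    h^-1 *: (f (h *: v + (h *: u + x)) - f (h *: u + x)) = 'D_v f (h *: u + x + c *: v).
  pose F (s : R) := f (h *: u + x + s *: v).
  have dF (s : R) : is_derive s 1 F ('D_v f (h *: u + x + s *: v)).
    by apply/is_derive_line; exact: derivableP.
  have cF (a b : R) : {within `[a, b], continuous F}.
    by apply: derivable_within_continuous => s _; exact: ex_derive.
  have F0 : F 0 = f (h *: u + x) by rewrite /F scale0r addr0.
  have Fh : F h = f (h *: v + (h *: u + x)) by rewrite /F addrC.
  rewrite -F0 -Fh; have [hp|hn|h00] := ltgtP 0 h; last by move: h0; rewrite -h00 eqxx.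
    have [c] := MVT_segment (ltW hp) (fun s _ => dF s) (cF _ _).
    rewrite in_itv/= => /andP[c0 ch] E; exists c; split.
      by rewrite !ger0_norm// ltW.
    by rewrite E subr0 /GRing.scale/= mulrC mulfK ?gt_eqF.
  have [c] := MVT_segment (ltW hn) (fun s _ => dF s) (cF _ _).
  rewrite in_itv/= => /andP[ch c0] E; exists c; split.
    by rewrite !ler0_norm ?lerN2// ltW.
  by rewrite -opprB E sub0r mulrN opprK /GRing.scale/= mulrC mulfK ?lt_eqF.
apply: xd; rewrite mx_norm_ball /ball_ /=.
rewrite -addrA addrCA opprD addrA subrr add0r normrN.
apply: le_lt_trans (ler_normD _ _) _; rewrite !normrZ.
apply: (@le_lt_trans _ _ (`|h| * M)).
  rewrite /M !mulrDr mulr1 -[leLHS]addr0 lerD// lerD2l ler_wpM2r//.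
rewrite -ltr_pdivlMr//; near: h; exact: hM.
Unshelve. all: end_near. Qed.

End directional.

(** * Smooth functions *)

Lemma continuous_mul {R : realType} {T : topologicalType} (f g : T -> R) :
  continuous f -> continuous g -> continuous (fun x => f x * g x).
Proof. by move=> cf cg x; apply: continuousM; [exact: cf|exact: cg]. Qed.

Lemma continuous_add {R : realType} {T : topologicalType} (f g : T -> R) :
  continuous f -> continuous g -> continuous (fun x => f x + g x).
Proof. by move=> cf cg x; apply: continuousD; [exact: cf|exact: cg]. Qed.

Section smooth_functions.
Context {R : realType} {n : nat}.
Implicit Types (f g : 'rV[R]_n -> R) (x : 'rV[R]_n) (i j : 'I_n).

Lemma smooth_continuous f : smooth f -> continuous f.
Proof. by move=> /(_ [::])[]. Qed.

Lemma smooth_pderiv f i : smooth f -> smooth (pderiv i f).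
Proof. by move=> sf s; have := sf (rcons s i); rewrite foldr_rcons. Qed.

Lemma smooth_is_derive f i x : smooth f ->
  is_derive x (delta_mx ord0 i) f (pderiv i f x).
Proof. by move=> /(_ [::])[_ /(_ i x)]; exact: derivableP. Qed.

(** Coinduction spares any formula for the iterated derivatives of products and
    bump functions: it is enough to exhibit a class stable under derivatives. *)
Lemma smooth_coind (P : ('rV[R]_n -> R) -> Prop) :
  (forall f, P f -> [/\ continuous f,
     forall i x, derivable f x (delta_mx ord0 i) & forall i, P (pderiv i f)]) ->
  forall f, P f -> smooth f.
Proof.
move=> HP f Pf s; have : P (foldr pderiv f s).
  by elim: s => //= i s IH; have [_ _] := HP _ IH; exact.
by move=> /HP[].
Qed.

Lemma smooth_cst (c : R) : smooth (cst c : 'rV[R]_n -> R).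
Proof.
apply: (@smooth_coind (fun f => exists c : R, f = cst c)); last by exists c.
move=> _ [a ->]; split; [exact: cst_continuous|by move=> i x; exact: derivable_cst|].
by move=> i; exists 0; apply/funext => x; rewrite /pderiv derive_cst.
Qed.

(** The class used for products: by the Leibniz rule, sums of products of smooth
    functions are stable under derivatives. *)
Inductive smooth_span : ('rV[R]_n -> R) -> Prop :=
| smooth_span_mul f g : smooth f -> smooth g -> smooth_span (fun x => f x * g x)
| smooth_span_add f g : smooth_span f -> smooth_span g ->
    smooth_span (fun x => f x + g x).

Lemma pderivM f g i x : smooth f -> smooth g ->
  is_derive x (delta_mx ord0 i) (fun y => f y * g y)
    (f x * pderiv i g x + pderiv i f x * g x).
Proof.
move=> sf sg; rewrite [_ f x * _]mulrC.
exact: is_deriveM (smooth_is_derive i x sf) (smooth_is_derive i x sg).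
Qed.

Lemma smoothM f g : smooth f -> smooth g -> smooth (fun x => f x * g x).
Proof.
move=> sf sg; apply: (@smooth_coind smooth_span); last exact: smooth_span_mul.
move=> h; elim=> {h sf sg f g} [f g sf sg|f g _ [cf df pf] _ [cg dg pg]]; split.
- exact: continuous_mul (smooth_continuous sf) (smooth_continuous sg).
- by move=> i x; apply: ex_derive; exact: pderivM.
- move=> i; rewrite (_ : pderiv _ _ =
      fun x => f x * pderiv i g x + pderiv i f x * g x).
    by apply: smooth_span_add; apply: smooth_span_mul => //; exact: smooth_pderiv.
  apply/funext => x; rewrite /pderiv.
  by have [_ ->] := pderivM i x sf sg.
- exact: continuous_add.
- by move=> i x; exact: derivableD.
- move=> i; rewrite (_ : pderiv _ _ = fun x => pderiv i f x + pderiv i g x).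
    exact: smooth_span_add.
  by apply/funext => x; rewrite /pderiv [LHS]deriveD.
Qed.

Lemma smooth_prod (I : Type) (r : seq I) (F : I -> 'rV[R]_n -> R) :
  (forall k, smooth (F k)) -> smooth (fun x => \prod_(k <- r) F k x).
Proof.
move=> sF; elim: r => [|k r IH].
  by under eq_fun do rewrite big_nil; exact: smooth_cst.
by under eq_fun do rewrite big_cons; exact: smoothM.
Qed.

End smooth_functions.

(** * Bump functions *)

Section bumps.
Context {R : realType}.
Implicit Types (p : {poly R}) (t y : R).

(** The functions p(1/t) exp(-1/t), extended by 0 to t <= 0, are stable under
    differentiation; the case p = 1 is the usual flat function. *)
Definition flat p t : R := if 0 < t then p.[t^-1] * expR (- t^-1) else 0.

Lemma expRN_le_fact k y : 0 < y -> y ^+ k * expR (- y) <= k.+1`!%:R / y.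
Proof.
move=> y0; rewrite expRN ler_pdivrMr ?expR_gt0// mulrAC ler_pdivlMr//.
rewrite -exprSr -ler_pdivrMl ?ltr0n ?fact_gt0//.
apply: le_trans (expR_ge1Dxn k (ltW y0)).
by rewrite mulrC lerDr.
Qed.

(** The exponential beats every power. A linear bound suffices for all purposes,
    as dividing [flat p] by t amounts to multiplying p by 'X. *)
Lemma flat_le p : exists2 C : R, 0 <= C & forall t, `|flat p t| <= C * `|t|.
Proof.
exists (\sum_(i < size p) `|p`_i| * i.+1`!%:R).
  by apply: sumr_ge0 => i _; rewrite mulr_ge0.
move=> t; rewrite /flat; case: ifPn => [t0|_]; last first.
  by rewrite normr0 mulr_ge0// sumr_ge0// => i _; rewrite mulr_ge0.
rewrite horner_coef mulr_suml mulr_suml.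
apply: le_trans (ler_norm_sum _ _ _) _; apply: ler_sum => i _.
rewrite -mulrA normrM -mulrA ler_wpM2l// ger0_norm; last first.
  by rewrite mulr_ge0 ?expR_ge0// exprn_ge0// invr_ge0 ltW.
apply: le_trans (expRN_le_fact _ _) _; first by rewrite invr_gt0.
by rewrite invrK gtr0_norm.
Qed.

Lemma is_derive_flat p t : is_derive t 1 (flat p) (flat ((p - p^`()) * 'X^2) t).
Proof.
have [t0|t0|t00] := ltgtP t 0; last rewrite {}t00.
- rewrite {2}/flat ltNge ltW//=; apply: near_eq_is_derive (is_derive_cst 0 t 1).
  near=> s; rewrite /flat; case: ifPn => // s0; suff : s < 0 by rewrite ltNge ltW.
  by near: s; exact: lt_nbhsl.
- have nz : t != 0 by rewrite gt_eqF.
  apply: (@near_eq_is_derive R R^o R^o (fun s => p.[s^-1] * expR (- s^-1))).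
    by near=> s; rewrite /flat ifT//; near: s; exact: lt_nbhsr.
  have dV : is_derive t 1 (fun s : R => s^-1) (- t ^- 2).
    have := is_deriveV nz (is_derive_id t 1).
    by rewrite /GRing.scale/= mulr1.
  have dp : is_derive t 1 (fun s : R => p.[s^-1]) ((p^`()).[t^-1] * - t ^- 2).
    exact: (is_derive1_comp (f := horner p) (is_derive_poly p t^-1) dV).
  have de : is_derive t 1 (fun s : R => expR (- s^-1)) (expR (- t^-1) * t ^- 2).
    have dN : is_derive t 1 (fun s : R => - s^-1) (t ^- 2).
      by have := is_deriveN dV; rewrite opprK.
    exact: (is_derive1_comp (f := expR) (g := fun s : R => - s^-1) (is_derive_expR (- t^-1)) dN).
  apply: is_derive_eq (is_deriveM dp de) _.
  rewrite /flat t0 !hornerE /GRing.scale/= expr2 invfM; ring.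
- have [C C0 hC] := flat_le (p * 'X).
  rewrite {2}/flat ltxx; apply: is_derive_of_cvg.
  rewrite {2}/flat ltxx; apply/cvgrPdist_le => e e0.
  have hh : \forall h \near (0 : R), `|h| < e / (C + 1).
    by apply: nbhs0_lt; rewrite divr_gt0// ltr_wpDl.
  rewrite near_withinE; near=> h => h0.
  rewrite sub0r normrN subr0 addr0 /GRing.scale/= mulr1.
  have -> : h^-1 * flat p h = flat (p * 'X) h.
    by rewrite /flat; case: ifP => _; [rewrite hornerMX mulrA [h^-1 * _]mulrC|rewrite mulr0].
  apply: le_trans (hC h) _.
  have : `|h| < e / (C + 1) by near: h; exact: hh.
  rewrite ltr_pdivlMr ?ltr_wpDl// => /ltW; apply: le_trans.
  by rewrite mulrC ler_wpM2l// lerDl.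
Unshelve. all: end_near. Qed.

Lemma continuous_flat p : continuous (flat p).
Proof.
by move=> t; apply/differentiable_continuous/derivable1_diffP/ex_derive/is_derive_flat.
Qed.

Lemma smooth_flat_coord n p (a b : R) (i : 'I_n) :
  smooth (fun x : 'rV[R]_n => flat p (a * x ord0 i + b)).
Proof.
have D q (x : 'rV[R]_n) j : is_derive x (delta_mx ord0 j)
    (fun x : 'rV[R]_n => flat q (a * x ord0 i + b))
    (flat ((a * (i == j)%:R) *: ((q - q^`()) * 'X^2)) (a * x ord0 i + b)).
  apply/is_derive_line0; set c := a * (i == j)%:R.
  rewrite (_ : (fun s => _) = flat q \o (fun s => a * x ord0 i + b + s * c)); last first.
    apply/funext => s /=; rewrite !mxE eqxx/= /c; congr flat.
    by rewrite mulrDr addrAC mulrCA.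
  have dl : is_derive (0 : R) 1 (fun s => a * x ord0 i + b + s * c) c.
    apply: is_derive_eq; rewrite [LHS]/= /GRing.scale/=; ring.
  have dq : is_derive (a * x ord0 i + b + 0 * c) 1 (flat q)
      (flat ((q - q^`()) * 'X^2) (a * x ord0 i + b)).
    by rewrite mul0r addr0; exact: is_derive_flat.
  apply: is_derive_eq (is_derive1_comp (g := fun s => a * x ord0 i + b + s * c) dq dl) _.
  rewrite /flat; case: ifP => _; rewrite ?mul0r// hornerZ; ring.
apply: (@smooth_coind _ _ (fun f => exists q,
  f = fun x : 'rV[R]_n => flat q (a * x ord0 i + b))); last by exists p.
move=> _ [q ->]; split.
- move=> x; apply: (@continuous_comp _ _ _ (fun x : 'rV[R]_n => a * x ord0 i + b)).
    apply: (continuous_add (continuous_mul (@cst_continuous _ _ a) (@coord_continuous _ _ _ _ _))).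
    exact: cst_continuous.
  exact: continuous_flat.
- by move=> j x; have [] := D q x j.
- move=> j; exists ((a * (i == j)%:R) *: ((q - q^`()) * 'X^2)).
  by apply/funext => x; rewrite /pderiv; have [_ ->] := D q x j.
Qed.

(** For growing k the factors exp (-1 / (k t)), with t the distance to a face, tend
    to 1 inside the box, while the support stays in the closed box. *)
Definition box_bump n (a b : 'I_n -> R) (k : nat) (x : 'rV[R]_n) : R :=
  \prod_i (flat 1 (k.+1%:R * x ord0 i + - (k.+1%:R * a i)) *
           flat 1 (- k.+1%:R * x ord0 i + k.+1%:R * b i)).

Lemma smooth_box_bump n (a b : 'I_n -> R) k : smooth (box_bump a b k).
Proof. by apply: smooth_prod => i; apply: smoothM; exact: smooth_flat_coord. Qed.

Lemma flat1_ge0 t : 0 <= flat 1 t.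
Proof. by rewrite /flat; case: ifP => // _; rewrite hornerE mul1r expR_ge0. Qed.

Lemma flat1_le1 t : flat 1 t <= 1.
Proof.
rewrite /flat; case: ifP => // t0.
by rewrite hornerE mul1r -expR0 ler_expR oppr_le0 invr_ge0 ltW.
Qed.

Lemma box_bump_ge0_le1 n (a b : 'I_n -> R) k x : 0 <= box_bump a b k x <= 1.
Proof.
rewrite /box_bump prodr_ge0 ?prodr_ile1// => i _; last by rewrite mulr_ge0 ?flat1_ge0.
by rewrite mulr_ge0 ?flat1_ge0//= mulr_ile1 ?flat1_ge0 ?flat1_le1.
Qed.

Lemma box_bump_notin n (a b : 'I_n -> R) k x : ~ obox a b x -> box_bump a b k x = 0.
Proof.
move=> /existsNP[i /negP abx]; rewrite /box_bump (bigD1 i)//=.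
suff -> : flat 1 (k.+1%:R * x ord0 i + - (k.+1%:R * a i)) *
  flat 1 (- k.+1%:R * x ord0 i + k.+1%:R * b i) = 0 by rewrite mul0r.
move: abx; rewrite negb_and -!leNgt => /orP[h|h].
  rewrite /flat [in X in X * _]ifF ?mul0r//; apply/negbTE.
  by rewrite -leNgt -mulrBr pmulr_rle0// subr_le0.
rewrite [X in _ * X]/flat [in X in _ * X]ifF ?mulr0//; apply/negbTE.
by rewrite -leNgt mulNr addrC -mulrBr pmulr_rle0// subr_le0.
Qed.

Lemma flat1_cvg (c : R) : 0 < c -> flat 1 (k.+1%:R * c) @[k --> \oo] --> (1 : R).
Proof.
move=> c0.
have -> : (fun k => flat 1 (k.+1%:R * c)) = expR \o (fun k => - (c^-1 * harmonic k)).
  apply/funext => k; rewrite /flat mulr_gt0// hornerE mul1r /=.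
  by rewrite invfM mulrC.
rewrite -[X in _ --> X]expR0; apply: continuous_cvg; first exact: continuous_expR.
rewrite -[X in _ --> X]oppr0; apply: cvgN.
rewrite -[X in _ --> X](mulr0 c^-1); apply: cvgMl_tmp; exact: cvg_harmonic.
Qed.

Lemma box_bump_cvg n (a b : 'I_n -> R) x : obox a b x ->
  box_bump a b k x @[k --> \oo] --> (1 : R).
Proof.
move=> abx; rewrite [X in _ --> X](_ : 1 = \prod_(i < n) (1 : R)); last by rewrite big1.
apply: cvg_big; first exact: mul_continuous.
move=> i _; have /andP[ai bi] := abx i; rewrite -[X in _ --> X](mulr1 1).
apply: cvgM.
  under eq_fun do rewrite -mulrBr.
  by apply: flat1_cvg; rewrite subr_gt0.
under eq_fun do rewrite addrC mulNr -mulrBr.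
by apply: flat1_cvg; rewrite subr_gt0.
Qed.

Lemma compact_cbox n (a b : 'I_n -> R) : compact (cbox a b).
Proof.
rewrite (_ : cbox a b = [set v : 'rV[R]_n | forall i, (`[a i, b i]%classic : set R) (v ord0 i)]).
  by apply: (@rV_compact R n (fun i => `[a i, b i]%classic : set R)) => i; exact: segment_compact.
by apply/seteqP; split=> x h i; have := h i; rewrite /= in_itv.
Qed.

Lemma closed_cbox n (a b : 'I_n -> R) : closed (cbox a b).
Proof. by apply: compact_closed; [exact: norm_hausdorff|exact: compact_cbox]. Qed.

Lemma box_bump_Ccoo n (a b : 'I_n -> R) k (A : set 'rV[R]_n) :
  cbox a b `<=` A -> Ccoo A (box_bump a b k).
Proof.
move=> abA; have sub : supp (box_bump a b k) `<=` cbox a b.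
  rewrite /supp (closure_id (cbox a b)).1; last exact: closed_cbox.
  apply: closureS => x /= /eqP xn0; apply: obox_sub_cbox.
  by apply: contrapT => H; apply: xn0; exact: box_bump_notin.
split; [exact: smooth_box_bump| |exact: subset_trans abA].
apply: subclosed_compact sub; last exact: compact_cbox.
exact: closed_closure.
Qed.

End bumps.

(** * Integrals invariant along a one-parameter family *)

Section invariant_integral.
Context {R : realType} {n : nat}.
Local Notation mu := (lebesgue_rV R n).

Lemma bounded_support_integrable (A : set 'rV[R]_n) (f : 'rV[R]_n -> R) (K : R) :
  measurable A -> (mu A < +oo)%E -> measurable_fun setT f ->
  (forall x, A x -> `|f x| <= K) -> (forall x, ~ A x -> f x = 0) ->
  mu.-integrable setT (EFin \o f).
Proof.
move=> mA Aoo mf fK f0.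
have -> : f = f \_ A.
  apply/funext => x; rewrite patchE; case: ifPn => // xA.
  by apply: f0 => /mem_set; exact/negP.
rewrite -restrict_EFin -integrable_mkcond//.
apply: measurable_bounded_integrable => //; first exact: measurable_funTS.
exists K; split; first exact: num_real.
by move=> y Ky x Ax; apply: le_trans (ltW Ky); exact: fK.
Qed.

(** This is what a divergence theorem would be used for: when the integral is
    invariant along a flow, the derivative along the flow integrates to zero, by
    dominated convergence of the difference quotients. *)
Lemma Rintegral_derive_cst (F : R -> 'rV[R]_n -> R) (a u v c K : R)
    (B : set 'rV[R]_n) :
  u < a < v -> measurable B -> (mu B < +oo)%E ->
  (forall t, u < t < v -> mu.-integrable setT (EFin \o F t)) ->
  (forall t, u < t < v -> \int[mu]_x F t x = c) ->
  (forall t x, u < t < v -> derivable (F^~ x) t 1) ->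
  (forall t x, u < t < v -> B x -> `|'D_1 (F^~ x) t| <= K) ->
  (forall t x, u < t < v -> ~ B x -> 'D_1 (F^~ x) t = 0) ->
  \int[mu]_x 'D_1 (F^~ x) a = 0.
Proof.
move=> uav mB Boo intF cF dF DK D0.
have uvE t : (`]u, v[%classic : set R) t -> u < t < v by rewrite /= in_itv.
pose G := ((fun=> `|K|) : 'rV[R]_n -> R) \_ B.
have Gge0 y : 0 <= G y by rewrite /G patchE; case: ifP.
have intG : mu.-integrable setT (EFin \o G).
  apply: (@bounded_support_integrable B _ `|K|) => //.
  - by apply/(measurable_restrictT _ _).1 => //; exact: measurable_cst.
  - by move=> x Bx; rewrite /G patchE mem_set// normr_id.
  - by move=> x Bx; rewrite /G patchE memNset.
have GU x y : `]u, v[%classic x -> setT y -> `|partial1of2 F x y| <= G y.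
  move=> /uvE xuv _; rewrite partial1of2E /G patchE; case: ifPn => [/set_mem|] By.
    by apply: le_trans (DK _ _ xuv By) (ler_norm _).
  by rewrite D0 ?normr0// => /mem_set; exact/negP.
have auv : `]u, v[%classic a by rewrite /= in_itv.
have := @cvg_differentiation_under_integral R _ _ mu F setT measurableT a u v auv
  (fun t h => intF t (uvE t h)) (fun t y h _ => dF t y (uvE t h)) G Gge0 intG GU.
have -> : (\int[mu]_x 'D_1 (F^~ x) a = \int[mu]_y partial1of2 F a y).
  by apply: eq_Rintegral => x _; rewrite partial1of2E.
move/(cvg_lim (@Rhausdorff R)) => <-; apply: (cvg_lim (@Rhausdorff R)).
apply: (cvg_near_cst 0).
have /andP[ua av] := uav.
have h1 : \forall h \near (0 : R), `|h| < Num.min (a - u) (v - a).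
  by apply: nbhs0_lt; rewrite lt_min !subr_gt0 ua av.
rewrite near_withinE; near=> h => h0.
have hr : `|h| < Num.min (a - u) (v - a) by near: h; exact: h1.
rewrite (cF a uav) cF ?subrr ?scaler0//.
move: hr; rewrite lt_min !ltr_norml => /andP[/andP[? ?] /andP[? ?]].
by apply/andP; split; lra.
Unshelve. all: end_near. Qed.

Lemma continuous_le_on_cbox (f : 'rV[R]_n -> R) (a b : 'I_n -> R) : continuous f ->
  exists2 K : R, 0 <= K & forall x, cbox a b x -> `|f x| <= K.
Proof.
move=> cf; have [[x0 x0ab]|/forallNP h] := pselect (exists x, cbox a b x); last first.
  by exists 0 => // x /h.
have cn : {within cbox a b, continuous (fun x => `|f x|)}.
  apply: continuous_subspaceT => x; apply: continuous_comp; first exact: cf.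
  exact: norm_continuous.
have [c _ hc] := @EVT_max_rV R n _ (cbox a b) (ex_intro _ x0 x0ab) (@compact_cbox _ _ _ _) cn.
by exists `|f c| => // x xab; apply: hc; rewrite inE.
Qed.

Lemma continuous_support_integrable (f : 'rV[R]_n -> R) (a b : 'I_n -> R) :
  continuous f -> (forall x, ~ cbox a b x -> f x = 0) ->
  mu.-integrable setT (EFin \o f).
Proof.
move=> cf f0; have [K _ fK] := continuous_le_on_cbox a b cf.
apply: (@bounded_support_integrable (cbox a b) _ K) => //.
- exact: measurable_cbox.
- exact: lebesgue_cbox_lty.
- exact: continuous_measurable_rV.
Qed.

(** Translation invariance along the i-th coordinate, differentiated. *)
Lemma Rintegral_pderiv_eq0 (h : 'rV[R]_n -> R) (i : 'I_n) (M : R) :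
  continuous h -> (forall x, derivable h x (delta_mx ord0 i)) ->
  continuous (pderiv i h) ->
  (forall x, ~ cbox (fun=> - M) (fun=> M) x -> h x = 0) ->
  (forall x, ~ cbox (fun=> - M) (fun=> M) x -> pderiv i h x = 0) ->
  \int[mu]_x pderiv i h x = 0.
Proof.
move=> ch dh cdh h0 dh0.
pose e : 'rV[R]_n := delta_mx ord0 i.
pose F (t : R) (x : 'rV[R]_n) := h (x + t *: e).
have DF (t : R) x : is_derive t 1 (F^~ x) (pderiv i h (x + t *: e)).
  by apply/is_derive_line; exact: derivableP.
have FE t : F t = h \o aff (fun=> 1) (fun j => t * (i == j)%:R).
  apply/funext => x; rewrite /F /=; congr h; apply/rowP => j.
  by rewrite !mxE eqxx mul1r eq_sym.
have [K K0 hK] := continuous_le_on_cbox (fun=> - M) (fun=> M) cdh.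
have DE (t : R) x : 'D_1 (F^~ x) t = pderiv i h (x + t *: e) by have [] := DF t x.
have -> : \int[mu]_x pderiv i h x = \int[mu]_x 'D_1 (F^~ x) 0.
  by apply: eq_Rintegral => x _; rewrite DE scale0r addr0.
have ih := continuous_support_integrable ch h0.
have T t := @Rintegral_aff R n (fun=> 1) (fun j => t * (i == j)%:R) h (fun=> ltr01) ih.
apply: (@Rintegral_derive_cst F 0 (-1) 1 (\int[mu]_x h x) K
  (cbox (fun=> - (M + 1)) (fun=> M + 1))).
- by rewrite ltrN10 ltr01.
- exact: measurable_cbox.
- exact: lebesgue_cbox_lty.
- by move=> t _; rewrite FE; have [] := T t.
- move=> t _; have [_ <-] := T t; rewrite big1 ?mul1r//.
  by rewrite FE.
- by move=> t x _; have [] := DF t x.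
- move=> t x _ _; rewrite DE.
  have [xM|/dh0 ->] := pselect (cbox (fun=> - M) (fun=> M) (x + t *: e)); first exact: hK.
  by rewrite normr0.
- move=> t x /andP[t1 t2] xM; rewrite DE; apply: dh0 => xt; apply: xM => j.
  have := xt j; rewrite !mxE eqxx/= => /andP[].
  case: (j == i); rewrite ?mulr1 ?mulr0 => ? ?; apply/andP; split; lra.
Qed.

End invariant_integral.

Lemma Rintegral_dominated d (T : measurableType d) (R : realType)
    (mu : {measure set T -> \bar R}) (D : set T) (f_ : nat -> T -> R) (f g : T -> R) :
  measurable D -> (forall k, measurable_fun D (f_ k)) -> measurable_fun D f ->
  (forall x, D x -> f_ k x @[k --> \oo] --> f x) ->
  mu.-integrable D (EFin \o g) ->
  (forall k x, D x -> `|f_ k x| <= g x) ->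
  \int[mu]_(x in D) f_ k x @[k --> \oo] --> \int[mu]_(x in D) f x.
Proof.
move=> mD mf_ mf cvf ig fg.
have [|||||if_ _ +] := @dominated_convergence _ _ _ mu D mD
  (fun k x => (f_ k x)%:E) (EFin \o f) (EFin \o g).
- by move=> k; exact/measurable_EFinP.
- exact/measurable_EFinP.
- by apply: aeW => x Dx; apply: cvg_EFin; [exact: nearW|exact: cvf].
- exact: ig.
- by apply: aeW => x k Dx; rewrite lee_fin; exact: fg.
rewrite -[X in _ --> X]fineK; last exact: integrable_fin_num.
by move/fine_cvg.
Qed.

(** * The fundamental lemma of the calculus of variations *)

Section fundamental_lemma.
Context {R : realType} {n : nat}.
Local Notation mu := (lebesgue_rV R n).

Definition oboxes : set (set 'rV[R]_n) := [set B | exists ab, B = obox ab.1 ab.2].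

Lemma setI_closed_oboxes : setI_closed oboxes.
Proof.
move=> _ _ [[a b] ->] [[a' b'] ->]; rewrite setI_obox.
by exists (fun i => Num.max (a i) (a' i), fun i => Num.min (b i) (b' i)).
Qed.

Lemma measurable_rV_oboxes : @measurable _ 'rV[R]_n = <<s oboxes >>.
Proof.
apply/seteqP; split; last first.
  apply: smallest_sub; first exact: sigma_algebra_measurable.
  by move=> _ [[a b] ->]; exact: measurable_obox.
apply: smallest_sub; first exact: smallest_sigma_algebra.
move=> B; rewrite -bigcup_seq => -[/= i _ [C mC <-]].
pose cT : g_sigma_algebraType oboxes -> measurableTypeR R := fun x => x ord0 i.
suff : measurable_fun setT cT by move=> /(_ measurableT _ mC).
apply: (measurability _ (RGenOpens.measurableE R)) => //.
move=> _ [_ [a [b ->]] <-]; rewrite setTI.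
have -> : cT @^-1` `]a, b[%classic = \bigcup_k obox
   (fun j => if j == i then a else - k%:R) (fun j => if j == i then b else k%:R).
  apply/seteqP; split=> [x /=|x [k _ /(_ i)]]; last first.
    by rewrite eqxx /= in_itv.
  rewrite in_itv /= => xab.
  exists (Num.truncn (\sum_j `|x ord0 j|)).+1 => // j.
  case: eqP => [->//|_]; rewrite -ltr_norml.
  apply: le_lt_trans (truncnS_gt _).
  by rewrite (bigD1 j)//= lerDl sumr_ge0.
apply: bigcup_measurable => k _; apply: sub_sigma_algebra.
by exists (fun j => if j == i then a else - k%:R, fun j => if j == i then b else k%:R).
Qed.

Variables (Omega : set 'rV[R]_n) (f : 'rV[R]_n -> R).
Hypothesis oO : open Omega.
Hypothesis intf : mu.-integrable Omega (EFin \o f).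
Hypothesis f0 : forall phi, Ccoo Omega phi -> \int[mu]_(x in Omega) (f x * phi x) = 0.

Let mO : measurable Omega := open_measurable_rV oO.
Let mf : measurable_fun Omega f.
Proof. by have /integrableP[/measurable_EFinP] := intf. Qed.

Let Rintegral_obox_eq0 a b : cbox a b `<=` Omega -> \int[mu]_(x in obox a b) f x = 0.
Proof.
move=> abO; have abO' : obox a b `<=` Omega := subset_trans (@obox_sub_cbox _ _ _ _) abO.
rewrite -(setIidr abO') Rintegral_mkcondr.
suff : \int[mu]_(x in Omega) (f x * box_bump a b k x) @[k --> \oo] -->
    \int[mu]_(x in Omega) (f \_ (obox a b)) x.
  move/(cvg_lim (@Rhausdorff R)) => <-; apply: (cvg_lim (@Rhausdorff R)).
  by apply: (cvg_near_cst 0); apply: nearW => k; rewrite f0//; exact: box_bump_Ccoo.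
apply: (Rintegral_dominated (g := fun x => `|f x|)) => //.
- move=> k; apply: measurable_funM => //; apply: continuous_measurable_rV.
  exact: smooth_continuous (smooth_box_bump _ _ _).
- by apply: measurable_funTS; apply/(measurable_restrictT _ _).1;
    [exact: measurable_obox|exact: measurable_funS mf].
- move=> x Ox; rewrite patchE; case: ifPn => [/set_mem xab|/negP xab].
    by rewrite -[X in _ --> X]mulr1; apply: cvgMl_tmp; exact: box_bump_cvg.
  by apply: (cvg_near_cst 0); apply: nearW => k; rewrite box_bump_notin ?mulr0// => /mem_set.
- exact: integrable_norm.
- move=> k x _; rewrite normrM ler_piMr//; have /andP[b0 b1] := box_bump_ge0_le1 a b k x.
  by rewrite ger0_norm.
Qed.

(** The integral of [f] vanishes on boxes, hence on every Borel subset of a box,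
    since boxes form a pi-system that generates the Borel sets. *)
Let ae_obox_eq0 a b : cbox a b `<=` Omega ->
  {ae mu, forall x, obox a b x -> f x = 0}.
Proof.
move=> abO; have abO' : obox a b `<=` Omega := subset_trans (@obox_sub_cbox _ _ _ _) abO.
have mQ : measurable (obox a b) by exact: measurable_obox.
have ifQ : mu.-integrable (obox a b) (EFin \o f) by exact: integrableS intf.
have ifE E : measurable E -> mu.-integrable (E `&` obox a b) (EFin \o f).
  by move=> mE; apply: integrableS ifQ => //; exact: measurableI.
suff H E : measurable E -> \int[mu]_(x in E `&` obox a b) f x = 0.
  have := @integral_ae_eq _ _ _ mu (obox a b) mQ (cst 0%E) (EFin \o f) ifQ.
  move=> /(_ (@measurable_cst _ _ _ _ _ _)) h.
  have {}h : ae_eq mu (obox a b) (EFin \o f) (cst 0%E).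
    apply: h => E EQ mE; rewrite integral0; have := H E mE.
    rewrite (setIidl EQ) /Rintegral => fE0.
    rewrite -[LHS]fineK ?fE0//; apply: integrable_fin_num => //.
    by have := ifE _ mE; rewrite (setIidl EQ).
  by apply: filterS h => x hx Qx; have [] := hx Qx.
rewrite measurable_rV_oboxes; move: E.
apply: (@dynkin_induction _ 'rV[R]_n oboxes
  (fun E => \int[mu]_(x in E `&` obox a b) f x = 0)).
- exact: measurable_rV_oboxes.
- exact: setI_closed_oboxes.
- by rewrite setTI; exact: Rintegral_obox_eq0.
- move=> _ [[a' b'] ->] /=; rewrite setI_obox; apply: Rintegral_obox_eq0.
  move=> x xab; apply: abO => i; have := xab i; rewrite ge_max le_min.
  by move=> /andP[/andP[_ ->] /andP[_ ->]].
- move=> S mS S0; have := Rintegral_obox_eq0 abO.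
  rewrite -[X in Rintegral _ X](setTI (obox a b)) -(setUv S) setIUl Rintegral_setU//.
  + by rewrite S0 add0r.
  + exact: measurableI.
  + by apply: measurableI => //; exact: measurableC.
  + by rewrite -setIUl setUv setTI.
  + by apply/disj_setPS => x [[Sx _] [/(_ Sx)]].
- move=> F mF tF F0; rewrite setI_bigcupl /Rintegral integral_bigcup.
  + rewrite eseries0// => k _ _; have := F0 k; rewrite /Rintegral => fE0.
    by rewrite -[LHS]fineK ?fE0//; apply: integrable_fin_num => //;
      [exact: measurableI|exact: ifE].
  + exact: trivIset_setIr.
  + by move=> k; exact: measurableI.
  + by rewrite -setI_bigcupl; apply: ifE; exact: bigcupT_measurable.
Qed.

Theorem fundamental_lemma : {ae mu, forall x, Omega x -> f x = 0}.
Proof.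
pose lo (p : 'rV[rat]_n * 'rV[rat]_n) i : R := ratr (p.1 ord0 i).
pose hi (p : 'rV[rat]_n * 'rV[rat]_n) i : R := ratr (p.2 ord0 i).
pose N k := [set x | exists p, [/\ unpickle k = Some p,
   cbox (lo p) (hi p) `<=` Omega, obox (lo p) (hi p) x & f x <> 0]].
have : mu.-negligible (\bigcup_k N k).
  apply: negligible_bigcup => k.
  have [/= [p [kp pO]]|/forallNP h] := pselect (exists p : 'rV[rat]_n * 'rV[rat]_n,
      unpickle k = Some p /\ cbox (lo p) (hi p) `<=` Omega); last first.
    by apply: (@negligibleS _ _ _ mu set0 _ _ (negligible_set0 mu)) => x [p [kp pO _ _]]; apply: (h p).
  apply: negligibleS (ae_obox_eq0 pO) => x [q [kq _]].
  by move: kq; rewrite kp => -[->] xq fx /(_ xq).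
apply: negligibleS => x /= /not_implyP[Ox fx].
have [p [px pO]] := open_rat_box oO Ox.
by exists (pickle p) => //; exists p; split => //; rewrite pickleK.
Qed.

End fundamental_lemma.

(** * The Bessel function J_0 as a function of the squared radius *)

Section bessel.
Context {R : realType}.
Implicit Types (m k : nat) (z s : R).

(** [bclifford m] is, up to sign conventions, the Bessel-Clifford function of
    order m: J_0(x) = bclifford 0 (x^2/4), and differentiation raises m by one. *)
Definition bclifford_coef m k : R := (-1) ^+ (k + m) / (k`! * (k + m)`!)%N%:R.
Definition bclifford m z : R := limn (pseries (bclifford_coef m) z).

Lemma pseries_diffs_bclifford m :
  pseries_diffs (bclifford_coef m) = bclifford_coef m.+1.
Proof.
apply/funext => k; rewrite /pseries_diffs /bclifford_coef addSnnS mulrCA; congr (_ * _).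
rewrite factS -mulnA natrM invfM mulrA mulfV ?mul1r//.
Qed.

Lemma is_cvg_bclifford m z : cvgn (pseries (bclifford_coef m) z).
Proof.
apply: normed_cvg; apply: (series_le_cvg (v_ := exp_coeff `|z|)).
- by move=> k; rewrite normr_ge0.
- by move=> k; rewrite exp_coeff_ge0.
- move=> k; rewrite /bclifford_coef /exp_coeff/= !normrM normrX normrN1 expr1n mul1r normrX.
  rewrite mulrC ler_wpM2l ?exprn_ge0//.
  rewrite normfV ger0_norm// lef_pV2 ?posrE ?ltr0n ?muln_gt0 ?fact_gt0//.
  by rewrite ler_nat leq_pmulr// fact_gt0.
- exact: is_cvg_series_exp_coeff.
Qed.

Lemma is_derive_bclifford m z : is_derive z 1 (bclifford m) (bclifford m.+1 z).
Proof.
have := @pseries_snd_diffs R (bclifford_coef m) (`|z| + 1) z.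
rewrite !pseries_diffs_bclifford; apply; try exact: is_cvg_bclifford.
by rewrite [ltRHS]ger0_norm// ltrDl.
Qed.

Lemma continuous_bclifford m : continuous (bclifford m).
Proof.
move=> z; apply/differentiable_continuous/derivable1_diffP.
by have [] := is_derive_bclifford m z.
Qed.

(** Every coefficient of the left-hand side vanishes; this is the Bessel equation
    in the variable x^2/4. *)
Lemma bclifford_ode z : z * bclifford 2 z + bclifford 1 z + bclifford 0 z = 0.
Proof.
have c2 : z * pseries (bclifford_coef 2) z k @[k --> \oo] --> z * bclifford 2 z.
  by apply: cvgMl_tmp; exact: is_cvg_bclifford.
have c1 : pseries (bclifford_coef 1) z k.+1 @[k --> \oo] --> bclifford 1 z.
  by rewrite (cvg_shiftS (pseries _ z)); exact: is_cvg_bclifford.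
have c0 : pseries (bclifford_coef 0) z k.+1 @[k --> \oo] --> bclifford 0 z.
  by rewrite (cvg_shiftS (pseries _ z)); exact: is_cvg_bclifford.
rewrite -(cvg_lim (@Rhausdorff R) (cvgD (cvgD c2 c1) c0)).
apply: (cvg_lim (@Rhausdorff R)); apply: (cvg_near_cst 0); apply: nearW => k.
rewrite /pseries /series /= !fctE !big_nat_recl//= mulr_sumr.
have sum5 (a b c d e : R) : a + (b + c) + (d + e) = b + d + (a + (c + e)) by ring.
rewrite sum5 -!big_split /= big1 ?addr0 => [|j _].
  rewrite /bclifford_coef !expr0 !mulr1 !addn0 add0n expr1 fact0 (factS 0) fact0 !muln1.
  by rewrite divr1 divr1 addNr.
rewrite mulrCA -exprS -!mulrDl; apply/eqP; rewrite mulf_eq0; apply/orP; left; apply/eqP.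
rewrite /bclifford_coef !addn0 addn1 addn2 !exprS !factS !natrM !mulN1r !opprK.
have f0 : j`!%:R != 0 :> R by rewrite pnatr_eq0 -lt0n fact_gt0.
have -> : j.+2%:R = j%:R + 2 :> R by rewrite -addn2 natrD.
have -> : j.+1%:R = j%:R + 1 :> R by rewrite -addn1 natrD.
have j0 : 0 <= j%:R :> R by [].
have j1 : j%:R + 1 != 0 :> R by rewrite gt_eqF// ltr_wpDl.
have j2 : j%:R + 2 != 0 :> R by rewrite gt_eqF// ltr_wpDl.
by field; rewrite f0 j1 j2.
Qed.

Lemma besselJ0E x : besselJ 0 x = bclifford 0 (x ^+ 2 / 4) :> R.
Proof.
rewrite /besselJ /bclifford /pseries; congr (limn (series _)); apply/funext => k.
rewrite /bclifford_coef !addn0 mulrC [RHS]mulrC; congr (_ * _).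
  by rewrite exprM; congr (_ ^+ _); field.
by rewrite !addn0.
Qed.

Lemma bclifford00 : bclifford 0 0 = 1 :> R.
Proof.
apply: (cvg_lim (@Rhausdorff R)).
apply: (@cvg_near_cst nat R^o (1 : R) (pseries (bclifford_coef 0) 0) \oo); exists 1%N => // -[//|k] _.
rewrite /pseries /series /= big_nat_recl//= big1 ?addr0 => [|j _].
  by rewrite /bclifford_coef !expr0 !mulr1 mul1r invr1.
by rewrite expr0n mulr0.
Qed.

(** J_0 equals 1 at 0: by the intermediate value theorem, a nonpositive value
    would produce a zero below the infimum [bessel_j0]. *)
Lemma bclifford0_gt0 z : 0 <= z -> 4 * z < bessel_j0 ^+ 2 -> 0 < bclifford 0 z.
Proof.
move=> z0 zj; rewrite ltNge; apply/negP => Ez.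
have [|z1 /[!in_itv]/= /andP[z10 z1z] E1] :=
    @IVT R (bclifford 0) 0 z 0 z0 (continuous_subspaceT (@continuous_bclifford 0)).
  by rewrite bclifford00 ge_min le_max Ez ler01 orbT.
have z1p : 0 < z1.
  by rewrite lt_def z10 andbT; apply/eqP => z1E; move: E1; rewrite z1E bclifford00 => /eqP; rewrite oner_eq0.
pose x := 2 * Num.sqrt z1.
have x2 : x ^+ 2 = 4 * z1 by rewrite exprMn sqr_sqrtr//; congr (_ * _); rewrite -natrX.
have xA : [set x : R | 0 < x /\ besselJ 0 x = 0] x.
  split; first by rewrite mulr_gt0// sqrtr_gt0.
  by rewrite besselJ0E x2 mulrAC divff ?mul1r.
have j0x : bessel_j0 <= x.
  by apply: ge_inf => //; exists 0 => y [/ltW].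
have j00 : 0 <= bessel_j0 :> R.
  by apply: lb_le_inf; [exists x|move=> y [/ltW]].
have : bessel_j0 ^+ 2 <= x ^+ 2 by rewrite ler_sqr ?nnegrE// (le_trans j00).
rewrite x2 leNgt => /negP; apply; apply: le_lt_trans zj.
by rewrite ler_pM2l.
Qed.

(** The logarithmic derivative of s |-> J_0(sqrt (c s)); the last identity is
    the Riccati form of the Bessel equation. *)
Lemma bessel_riccati (c S : R) : 0 < c -> 0 <= S -> c * S < bessel_j0 ^+ 2 ->
  exists (k dk : R -> R) (K : R), [/\ measurable_fun `[0, S] k,
    measurable_fun `[0, S] dk & forall s, 0 <= s <= S ->
    [/\ is_derive s 1 k (dk s), `|k s| <= K, `|dk s| <= K &
        s * dk s + k s + s * k s ^+ 2 = - (c / 4)]].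
Proof.
move=> c0 S0 cS; pose l := c / 4; have l0 : 0 < l by rewrite divr_gt0.
pose e m s := bclifford m (l * s).
have e0 s : 0 <= s <= S -> 0 < e 0 s.
  move=> /andP[s0 sS]; apply: bclifford0_gt0; first by rewrite mulr_ge0// ltW.
  apply: le_lt_trans cS; rewrite /l mulrA mulrCA mulfV ?mulr1//.
  by rewrite ler_pM2l.
have de m s : is_derive s 1 (e m) (l * e m.+1 s).
  rewrite mulrC; apply: (is_derive1_comp (f := bclifford m) (g := fun s => l * s)).
    exact: is_derive_bclifford.
  by apply: is_derive_eq; rewrite /GRing.scale/= mulr1.
have ce m : continuous (e m).
  by move=> s; apply/differentiable_continuous/derivable1_diffP; have [] := de m s.
pose k s := l * (e 1 s / e 0 s).
pose dk s := l ^+ 2 * (e 2 s / e 0 s - (e 1 s / e 0 s) ^+ 2).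
have bd (f : R -> R) : {within `[0, S], continuous f} ->
    exists2 K : R, 0 <= K & forall s, 0 <= s <= S -> `|f s| <= K.
  move=> cf; have cn : {within `[0, S], continuous (fun s => `|f s|)}.
    move=> s; apply: continuous_comp; first exact: cf.
    exact: norm_continuous.
  have [x _ hx] := EVT_max S0 cn; exists `|f x| => // s sS; exact: hx.
have cV : {within `[0, S], continuous (fun s => (e 0 s)^-1)}.
  apply: continuous_in_subspaceT => s; rewrite inE /= in_itv /= => /e0 h.
  by apply: continuousV; [rewrite gt_eqF|exact: ce].
have cq m : {within `[0, S], continuous (fun s => e m s / e 0 s)}.
  move=> s; apply: continuousM; last exact: cV.
  by apply: continuous_subspaceT; exact: ce.
have [K1 K10 hK1] := bd _ (cq 1).
have [K2 K20 hK2] := bd _ (cq 2).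
have mq m : measurable_fun `[0, S] (fun s => e m s / e 0 s).
  by apply: subspace_continuous_measurable_fun => //; exact: cq.
exists k, dk, (l * K1 + l ^+ 2 * (K2 + K1 ^+ 2)); split.
- exact: measurable_funM.
- apply: measurable_funM => //; apply: measurable_funB => //; exact: measurable_funX.
move=> s sS.
have es : e 0 s != 0 by rewrite gt_eqF// e0.
split.
- have := is_deriveM (de 1 s) (is_deriveV es (de 0 s)).
  move=> /(is_deriveZ l) /is_derive_eq; apply.
  rewrite /dk /GRing.scale/=.
  by field.
- rewrite normrM (gtr0_norm l0) -[leLHS]addr0 lerD//.
    by rewrite ler_wpM2l ?(ltW l0)// hK1.
  by rewrite mulr_ge0 ?exprn_ge0 ?(ltW l0)// addr_ge0// exprn_ge0.
- rewrite normrM (ger0_norm (exprn_ge0 _ (ltW l0))) -[leLHS]add0r lerD//.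
    by rewrite mulr_ge0 ?(ltW l0).
  rewrite ler_wpM2l ?exprn_ge0 ?(ltW l0)//.
  apply: le_trans (ler_normB _ _) _; rewrite lerD ?hK2// normrX.
  by rewrite ler_sqr ?nnegrE ?hK1.
- have := bclifford_ode (l * s); rewrite -!/(e _ s) /k /dk -/l => ode.
  have -> : s * (l ^+ 2 * (e 2 s / e 0 s - (e 1 s / e 0 s) ^+ 2)) + l * (e 1 s / e 0 s) +
     s * (l * (e 1 s / e 0 s)) ^+ 2 = l * ((l * s * e 2 s + e 1 s) / e 0 s) by field.
  have -> : l * s * e 2 s + e 1 s = - e 0 s by apply/eqP; rewrite -addr_eq0 ode.
  by rewrite mulNr divff// mulrN1.
Qed.

End bessel.

(** * Dilations of the last two coordinates and the sector *)

Lemma near_gt {R : realType} {T : topologicalType} (f : T -> R) (p : T) (c : R) :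
  {for p, continuous f} -> c < f p -> \forall x \near p, c < f x.
Proof. by move=> cf; apply: cvgr_gt. Qed.

Lemma near_lt {R : realType} {T : topologicalType} (f : T -> R) (p : T) (c : R) :
  {for p, continuous f} -> f p < c -> \forall x \near p, f x < c.
Proof. by move=> cf; apply: cvgr_lt. Qed.

Section dilation.
Context {R : realType} {n : nat}.
Implicit Types (x p : 'rV[R]_n.+2) (t : R).

Local Notation penult := (inord n : 'I_n.+2).

Definition dil t : 'rV[R]_n.+2 -> 'rV[R]_n.+2 :=
  aff (fun i => if (i < n)%N then 1 else t) (fun=> 0).

Lemma penultE : (penult : nat) = n.
Proof. by rewrite inordK. Qed.

Lemma ord2_cases (i : 'I_n.+2) : [\/ (i < n)%N, i = penult | i = ord_max].
Proof.
have := ltn_ord i; rewrite ltnS leq_eqVlt => /orP[/eqP h|].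
  by apply: Or33; exact/val_inj.
rewrite ltnS leq_eqVlt => /orP[/eqP h|]; last exact: Or31.
by apply: Or32; apply/val_inj; rewrite /= penultE.
Qed.

Lemma penult_dil t x : penult_coord (dil t x) = t * penult_coord x.
Proof. by rewrite /penult_coord !mxE penultE ltnn addr0. Qed.

Lemma last_dil t x : last_coord (dil t x) = t * last_coord x.
Proof. by rewrite /last_coord !mxE ltnNge leqnSn addr0. Qed.

Lemma dil1 x : dil 1 x = x.
Proof. by apply/rowP => i; rewrite !mxE if_same mul1r addr0. Qed.

(** The velocity of the path t |-> [dil t x]. *)
Definition dil_dir x : 'rV[R]_n.+2 :=
  penult_coord x *: delta_mx ord0 penult + last_coord x *: delta_mx ord0 ord_max.

Lemma dil_line t x : dil t x = dil 0 x + t *: dil_dir x.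
Proof.
apply/rowP => i; rewrite !mxE eqxx/= !addr0.
have [h|->|->] := ord2_cases i.
- rewrite h; have -> : (i == penult) = false.
    by apply/negbTE; apply: contraTneq h => ->; rewrite penultE ltnn.
  have -> : (i == ord_max) = false.
    by apply/negbTE; apply: contraTneq h => ->; rewrite /= ltnNge leqnSn.
  by rewrite !mulr0 addr0 mulr0 addr0.
- rewrite penultE ltnn eqxx; have -> : (penult == ord_max) = false.
    by apply/negbTE/eqP => /(congr1 val) /=; rewrite penultE => /n_Sn.
  by rewrite mul0r add0r mulr1 mulr0 addr0.
- rewrite /= ltnNge leqnSn/=; have -> : (ord_max == penult) = false.
    by apply/negbTE/eqP => /(congr1 val) /=; rewrite penultE => /esym/n_Sn.
  by rewrite eqxx mul0r add0r mulr1 mulr0 add0r.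
Qed.

Lemma prod_dil t : \prod_(i < n.+2) (if (i < n)%N then 1 else t) = t ^+ 2.
Proof.
rewrite !big_ord_recr/= ltnn ltnNge leqnSn/= big1 ?mul1r ?expr2// => i _.
by rewrite ltn_ord.
Qed.

Lemma sector_dil beta t t' x : 0 < t -> 0 < t' ->
  sector beta (dil t x) -> sector beta (dil t' x).
Proof.
move=> t0 t'0 [rho [theta [r0 th]]]; rewrite penult_dil last_dil => h1 h2.
exists (t' / t * rho), theta; split => //.
- by rewrite mulr_gt0// divr_gt0.
- rewrite penult_dil -[X in _ * X](mulKf (lt0r_neq0 t0)) h1; ring.
- rewrite last_dil -[X in _ * X](mulKf (lt0r_neq0 t0)) h2; ring.
Qed.

Lemma continuous_dil x : continuous (dil^~ x).
Proof.
rewrite (_ : dil^~ x = fun t => dil 0 x + t *: dil_dir x); last first.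
  by apply/funext => t; exact: dil_line.
move=> t; apply: cvgD; first exact: cvg_cst.
by apply: cvgZr_tmp; exact: cvg_id.
Qed.

Lemma continuous_penult : continuous (@penult_coord R n).
Proof. by move=> x; exact: coord_continuous. Qed.

Lemma continuous_last : continuous (@last_coord R n).
Proof. by move=> x; exact: coord_continuous. Qed.

(** Near a point of angle theta the polar angle is
    theta + atan (b / a), where (a, b) are the coordinates in the frame rotated
    by theta; this depends continuously on the point. *)
Lemma open_sector (beta : R) : open (sector beta : set 'rV[R]_n.+2).
Proof.
rewrite openE => p [rho [theta [rho0 /andP[th0 thb] pE lE]]].
pose a x := penult_coord x * cos theta + last_coord x * sin theta.
pose b x := last_coord x * cos theta + penult_coord x * - sin theta.
have ca : continuous a.
  by apply: continuous_add; apply: continuous_mul;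
    [exact: continuous_penult|exact: cst_continuous|exact: continuous_last|exact: cst_continuous].
have cb : continuous b.
  by apply: continuous_add; apply: continuous_mul;
    [exact: continuous_last|exact: cst_continuous|exact: continuous_penult|exact: cst_continuous].
have ap : a p = rho.
  by rewrite /a pE lE -!mulrA -mulrDr -!expr2 cos2Dsin2 mulr1.
have bp : b p = 0 by rewrite /b pE lE mulrN mulrAC subrr.
pose ang x := theta + atan (b x / a x).
have cang : {for p, continuous ang}.
  apply: continuousD; first exact: cst_continuous.
  apply: continuous_comp; last exact: continuous_atan.
  apply: continuousM; first exact: cb.
  have := @continuousV _ _ a p; apply; first by rewrite ap gt_eqF.
  exact: ca.
have angp : ang p = theta by rewrite /ang bp mul0r atan0 addr0.
have na : \forall x \near p, 0 < a x.
  by apply: near_gt; [exact: ca|rewrite ap].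
have n1 : \forall x \near p, 0 < ang x.
  by apply: near_gt; [exact: cang|rewrite angp].
have n2 : \forall x \near p, ang x < beta.
  by apply: near_lt; [exact: cang|rewrite angp].
rewrite /interior /=; near=> x.
have ax : 0 < a x by near: x.
pose q := Num.sqrt (1 + (b x / a x) ^+ 2).
have q0 : 0 < q by rewrite sqrtr_gt0 ltr_wpDr ?sqr_ge0.
have anz : a x != 0 by rewrite gt_eqF.
have qnz : q != 0 by rewrite gt_eqF.
have ct : cos (atan (b x / a x)) = q^-1 by rewrite cos_atan.
have st : sin (atan (b x / a x)) = b x / a x / q.
  by have /(congr1 (fun z => z / q)) := atanK (b x / a x); rewrite /tan ct invrK mulfK.
exists (a x * q), (ang x); split.
- by rewrite mulr_gt0.
- by apply/andP; split; near: x.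
- rewrite cosD ct st.
  have -> : a x * q * (cos theta / q - sin theta * (b x / a x / q)) =
    a x * cos theta - b x * sin theta by field; rewrite anz qnz.
  rewrite /a /b -[LHS]mulr1 -(cos2Dsin2 theta); ring.
- rewrite sinD ct st.
  have -> : a x * q * (sin theta / q + cos theta * (b x / a x / q)) =
    a x * sin theta + b x * cos theta by field; rewrite anz qnz.
  rewrite /a /b -[LHS]mulr1 -(cos2Dsin2 theta); ring.
Unshelve. all: end_near. Qed.

End dilation.

Lemma continuous_bounded_integrable {R : realType} n (D : set 'rV[R]_n) (f : 'rV[R]_n -> R) :
  measurable D -> bounded_set D -> continuous f ->
  (lebesgue_rV R n).-integrable D (EFin \o f).
Proof.
move=> mD bD cf; have [M _ DM] := bounded_box bD.
have [K _ fK] := continuous_le_on_cbox (fun=> - M) (fun=> M) cf.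
apply: measurable_bounded_integrable => //.
- exact: bounded_lebesgue_lty.
- exact: continuous_measurable_rV.
- exists K; split; first exact: num_real.
  by move=> y Ky x Dx; apply: le_trans (ltW Ky); exact/fK/DM.
Qed.

(** * The Poincare inequality on test functions *)

Section poincare.
Context {R : realType} {n : nat}.
Local Notation mu := (lebesgue_rV R n.+2).
Local Notation penult := (inord n : 'I_n.+2).
Implicit Types (x p : 'rV[R]_n.+2) (t : R).

Definition rad2 p : R := penult_coord p ^+ 2 + last_coord p ^+ 2.

Lemma continuous_rad2 : continuous rad2.
Proof.
by apply: continuous_add; apply: continuous_mul;
  first [exact: continuous_penult | exact: continuous_last].
Qed.

Lemma rad2_ge0 p : 0 <= rad2 p.
Proof. by rewrite addr_ge0 ?sqr_ge0. Qed.

Lemma rad2_dil t x : rad2 (dil t x) = t ^+ 2 * rad2 x.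
Proof. by rewrite /rad2 penult_dil last_dil; ring. Qed.

Section radial_derivative.
Variable phi : 'rV[R]_n.+2 -> R.
Hypothesis sphi : smooth phi.

(** The radial derivative x' . grad phi. *)
Definition euler p : R :=
  penult_coord p * pderiv penult phi p + last_coord p * pderiv ord_max phi p.

Lemma continuous_euler : continuous euler.
Proof.
by apply: continuous_add; apply: continuous_mul;
  first [exact: continuous_penult | exact: continuous_last |
         exact: smooth_continuous (smooth_pderiv _ sphi)].
Qed.

Lemma is_derive_dil x t : t != 0 ->
  is_derive t 1 (fun s : R => phi (dil s x)) (t^-1 * euler (dil t x)).
Proof.
move=> t0.
rewrite (_ : (fun s : R => phi (dil s x)) = fun s => phi (dil 0 x + s *: dil_dir x)); last first.
  by apply/funext => s; rewrite dil_line.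
apply/is_derive_line; rewrite -dil_line.
have DZ (a : R) i y : is_derive y (a *: delta_mx ord0 i) phi (a * pderiv i phi y).
  exact: is_derive_dirZ (smooth_is_derive i y sphi).
have DE (a : R) i y : 'D_(a *: delta_mx ord0 i) phi y = a * pderiv i phi y.
  by have [] := DZ a i y.
have DC i a : continuous ('D_(a *: delta_mx ord0 i) phi).
  rewrite (_ : 'D_(a *: delta_mx ord0 i) phi = fun y => a * pderiv i phi y); last first.
    by apply/funext => y; exact: DE.
  apply: continuous_mul; first exact: cst_continuous.
  exact: smooth_continuous (smooth_pderiv _ sphi).
apply: is_derive_eq (is_derive_dirD _ _ _) _.
- by have [] := DZ (penult_coord x) penult (dil t x).
- by move=> y; have [] := DZ (last_coord x) ord_max y.
- exact: DC.
- by rewrite !DE /euler penult_dil last_dil; field.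
Qed.

End radial_derivative.

Variables (beta : R) (Omega Gamma : set 'rV[R]_n.+2).
Hypotheses (oO : open Omega) (bO : bounded_set Omega) (sO : Omega `<=` sector beta).
Hypothesis hG : Gamma `<=` frontier (sector beta).
Variable phi : 'rV[R]_n.+2 -> R.
Hypothesis sphi : smooth phi.
Hypothesis phiO : supp phi `&` closure Omega `<=` Omega `|` Gamma.

Let mO : measurable Omega := open_measurable_rV oO.

(** Inside the sector, [phi] restricted to [Omega] extends by zero: there the
    boundary of [Omega] does not meet the support of [phi], because [Gamma] lies
    on the boundary of the sector. *)
Lemma test_extends_by_zero p : sector beta p -> ~ Omega p ->
  \forall q \near p, Omega q -> phi q = 0.
Proof.
move=> sp Op; have [pO|pO] := pselect (closure Omega p); last first.
  have : nbhs p (~` closure Omega).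
    by apply: open_nbhs_nbhs; split => //; apply: closed_openC; exact: closed_closure.
  by apply: filterS => q qO Oq; exfalso; apply: qO; exact: subset_closure.
have ps : ~ supp phi p.
  move=> ps; have [//|/hG[_]] := phiO (conj ps pO); apply.
  by have := @open_sector R n beta; rewrite openE; exact.
have : nbhs p (~` supp phi).
  by apply: open_nbhs_nbhs; split => //; apply: closed_openC; exact: closed_closure.
apply: filterS => q qs _; apply/eqP; apply: contrapT => /negP q0.
by apply: qs; exact: subset_closure.
Qed.

Variables (c S K : R) (k dk : R -> R).
Hypothesis OS : forall p, Omega p -> rad2 p <= S.
Hypotheses (mk : measurable_fun `[0, S] k) (mdk : measurable_fun `[0, S] dk).
Hypothesis kdk : forall s, 0 <= s <= S ->
  [/\ is_derive s 1 k (dk s), `|k s| <= K, `|dk s| <= K &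
      s * dk s + k s + s * k s ^+ 2 = - (c / 4)].

Let E := euler phi.
Let g := (fun p => phi p ^+ 2 * k (rad2 p)) \_ Omega.
(** On [Omega], half the divergence of the field g x'. *)
Let W p := phi p ^+ 2 * k (rad2 p) + phi p * E p * k (rad2 p)
  + rad2 p * phi p ^+ 2 * dk (rad2 p).
Let F t x := t * t * g (dil t x).

Let OSS p : Omega p -> 0 <= rad2 p <= S.
Proof. by move=> /OS ->; rewrite rad2_ge0. Qed.

Let is_derive_F t x : 0 < t -> is_derive t 1 (F^~ x) (2 * t * (W \_ Omega) (dil t x)).
Proof.
move=> t0; have tn0 : t != 0 by rewrite gt_eqF.
have near_dil (A : set 'rV[R]_n.+2) : nbhs (dil t x) A -> \forall s \near t, A (dil s x).
  exact: (@continuous_dil R n x t).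
have [Op|Op] := pselect (Omega (dil t x)); last first.
  rewrite patchE memNset// mulr0.
  apply: near_eq_is_derive (is_derive_cst 0 t 1).
  have [sp|sp] := pselect (sector beta (dil t x)).
    apply: filterS (near_dil _ (test_extends_by_zero sp Op)) => s h.
    by rewrite /F /g patchE; case: ifPn => [/set_mem/h ->|]; rewrite ?mulr0// expr0n mul0r mulr0.
  near=> s; rewrite /F /g patchE; case: ifPn; rewrite ?mulr0// => /set_mem/sO ss.
  exfalso; apply: sp; apply: sector_dil ss => //.
  by near: s; exact: lt_nbhsr.
have Fn : \forall s \near t, s * s * (phi (dil s x) * phi (dil s x) * k (s * s * rad2 x)) = F s x.
  have : nbhs (dil t x) Omega by exact: open_nbhs_nbhs.
  move=> /near_dil; apply: filterS => s Os.
  by rewrite /F /g patchE mem_set// rad2_dil !expr2.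
apply: (near_eq_is_derive Fn).
rewrite patchE mem_set//.
have dp := is_derive_dil sphi x tn0.
have ds : is_derive t 1 (fun s : R => s * s) (2 * t).
  apply: is_derive_eq (is_deriveM (is_derive_id t 1) (is_derive_id t 1)) _.
  by rewrite /GRing.scale/=; ring.
have dsr : is_derive t 1 (fun s : R => s * s * rad2 x) (2 * t * rad2 x).
  apply: is_derive_eq (is_deriveM ds (is_derive_cst (rad2 x) t 1)) _.
  by rewrite /GRing.scale/=; ring.
have rE : t * t * rad2 x = rad2 (dil t x) by rewrite rad2_dil expr2.
have [dkt _ _ _] := kdk (OSS Op).
have dkr : is_derive t 1 (fun s : R => k (s * s * rad2 x))
    (dk (rad2 (dil t x)) * (2 * t * rad2 x)).
  apply: (is_derive1_comp (f := k) (g := fun s => s * s * rad2 x)) => //.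
  by rewrite rE.
apply: is_derive_eq (is_deriveM ds (is_deriveM (is_deriveM dp dp) dkr)) _.
rewrite !fctE /GRing.scale/= rE /W /E rad2_dil.
by field.
Unshelve. all: end_near. Qed.

Let Obox : exists2 M : R, 0 < M & Omega `<=` cbox (fun=> - M) (fun=> M).
Proof. exact: bounded_box. Qed.

Let K0 p : Omega p -> 0 <= K.
Proof. by move=> /OSS/kdk[_ + _ _]; apply: le_trans. Qed.

Let mkO : measurable_fun Omega (k \o rad2).
Proof.
apply: (measurable_comp _ _ mk) => //; last exact: continuous_measurable_rV continuous_rad2.
by move=> _ [p Op <-] /=; rewrite in_itv; exact: OSS.
Qed.

Let mdkO : measurable_fun Omega (dk \o rad2).
Proof.
apply: (measurable_comp _ _ mdk) => //; last exact: continuous_measurable_rV continuous_rad2.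
by move=> _ [p Op <-] /=; rewrite in_itv; exact: OSS.
Qed.

Let mW : measurable_fun Omega W.
Proof.
have mp : measurable_fun Omega phi.
  by apply: continuous_measurable_rV; exact: smooth_continuous.
have mE : measurable_fun Omega E.
  by apply: continuous_measurable_rV; exact: continuous_euler.
have mr : measurable_fun Omega rad2.
  by apply: continuous_measurable_rV; exact: continuous_rad2.
apply: measurable_funD; first apply: measurable_funD.
- by apply: measurable_funM mkO; exact: measurable_funX.
- by apply: measurable_funM mkO; exact: measurable_funM.
- by apply: measurable_funM mdkO; apply: measurable_funM => //; exact: measurable_funX.
Qed.

Let bounded_W : exists2 KW : R, 0 <= KW & forall p, Omega p -> `|W p| <= KW.
Proof.
have [M _ OM] := Obox.
have [A A0 hA] := continuous_le_on_cbox (fun=> - M) (fun=> M) (smooth_continuous sphi).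
have [B B0 hB] := continuous_le_on_cbox (fun=> - M) (fun=> M) (continuous_euler sphi).
exists `|A ^+ 2 * K + A * B * K + S * A ^+ 2 * K| => // p Op; apply: le_trans (ler_norm _).
have KP := K0 Op; have [_ hk hdk _] := kdk (OSS Op).
have pA := hA p (OM p Op); have pB := hB p (OM p Op).
have pA2 : `|phi p| ^+ 2 <= A ^+ 2 by rewrite ler_sqr ?nnegrE.
apply: le_trans (ler_normD _ _) _; apply: lerD; first apply: le_trans (ler_normD _ _) (lerD _ _).
- by rewrite normrM normrX ler_pM ?exprn_ge0.
- by rewrite normrM (normrM (phi p)) !ler_pM ?mulr_ge0.
- rewrite normrM (normrM (rad2 p)) normrX (ger0_norm (rad2_ge0 p)) !ler_pM ?mulr_ge0 ?exprn_ge0 ?rad2_ge0//.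
  exact: OS.
Qed.

Let integrable_W : mu.-integrable Omega (EFin \o W).
Proof.
have [KW KW0 hKW] := bounded_W.
apply: measurable_bounded_integrable => //; first exact: bounded_lebesgue_lty.
exists KW; split; first exact: num_real.
by move=> y Ky x Ox; apply: le_trans (ltW Ky); exact: hKW.
Qed.

(** By the change of variables the integral of [F t] does not depend on t; its
    derivative at t = 1 is twice the integral of [W]. *)
Let Rintegral_W : \int[mu]_(p in Omega) W p = 0.
Proof.
have [M M0 OM] := Obox.
have [KW KW0 hKW] := bounded_W.
have [A A0 hA] := continuous_le_on_cbox (fun=> - M) (fun=> M) (smooth_continuous sphi).
have ig : mu.-integrable setT (EFin \o g).
  apply: (@bounded_support_integrable _ _ Omega _ (A ^+ 2 * K)) => //.
  - exact: bounded_lebesgue_lty.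
  - apply/(measurable_restrictT _ _).1 => //; apply: measurable_funM mkO.
    by apply: measurable_funX; apply: continuous_measurable_rV; exact: smooth_continuous.
  - move=> p Op; rewrite /g patchE mem_set// normrM normrX.
    have [_ hk _ _] := kdk (OSS Op).
    by rewrite ler_pM ?exprn_ge0// ler_sqr ?nnegrE ?hA//; exact: OM.
  - by move=> p Op; rewrite /g patchE memNset.
have pos t : 2^-1 < t < 2 -> 0 < t.
  by move=> /andP[+ _]; apply: lt_trans; rewrite invr_gt0.
have T t : 2^-1 < t < 2 -> mu.-integrable setT (EFin \o (g \o dil t)) /\
    t ^+ 2 * \int[mu]_x g (dil t x) = \int[mu]_x g x.
  move=> /pos t0; rewrite -(@prod_dil R n t); apply: Rintegral_aff => // i.
  by case: ifP.
have DF t x : 2^-1 < t < 2 -> is_derive t 1 (F^~ x) (2 * t * (W \_ Omega) (dil t x)).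
  by move=> /pos; exact: is_derive_F.
have I1 : (2^-1 : R) < (1 : R) < (2 : R) by apply/andP; split; lra.
have := @Rintegral_derive_cst R n.+2 F 1 2^-1 2 (\int[mu]_x g x) (2 * 2 * KW)
  (cbox (fun=> - (2 * M)) (fun=> 2 * M)) I1.
have -> : \int[mu]_x 'D_1 (F^~ x) 1 = 2 * \int[mu]_(p in Omega) W p.
  rewrite -RintegralZl//.
  rewrite [RHS]Rintegral_mkcond; apply: eq_Rintegral => x _; have [_ ->] := DF 1 x I1.
  by rewrite mulr1 dil1 !patchE; case: ifP; rewrite ?mulr0.
move=> H; apply/eqP; suff : 2 * \int[mu]_(p in Omega) W p = 0.
  by move=> /eqP; rewrite mulf_eq0 pnatr_eq0.
apply: H.
- exact: measurable_cbox.
- exact: lebesgue_cbox_lty.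
- move=> t tI; have [+ _] := T t tI => /(integrableZl measurableT (t * t)).
  by apply: eq_integrable => // x _; rewrite /F EFinM.
- move=> t tI; have [it <-] := T t tI.
  by rewrite -RintegralZl//; apply: eq_Rintegral => x _; rewrite /F expr2.
- by move=> t x tI; have [] := DF t x tI.
- move=> t x tI _; have [_ ->] := DF t x tI; have t0 := pos t tI.
  rewrite patchE; case: ifPn => [/set_mem Op|_]; last first.
    by rewrite mulr0 normr0 !mulr_ge0.
  rewrite normrM ler_pM ?hKW// gtr0_norm ?mulr_gt0// ler_pM2l//.
  by have /andP[_ /ltW] := tI.
- move=> t x tI xM; have [_ ->] := DF t x tI; have t0 := pos t tI.
  rewrite patchE memNset ?mulr0// => /OM Op; apply: xM => i.
  have := Op i; rewrite !mxE addr0 => /andP[]; have /andP[t1 _] := tI.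
  case: ifP => _.
    by rewrite mul1r => ? ?; apply/andP; split; lra.
  have t2 : 1 < 2 * t by rewrite -ltr_pdivrMl// mulr1.
  by move=> ? ?; apply/andP; split; nra.
Qed.

Lemma poincare_test_aux :
  c * \int[mu]_(x in Omega) (phi x ^+ 2) <=
  \int[mu]_(x in Omega) (\sum_i pderiv i phi x ^+ 2).
Proof.
have cp := smooth_continuous sphi.
have iW := integrable_W.
have ip : mu.-integrable Omega (EFin \o (fun x => phi x ^+ 2)).
  by apply: continuous_bounded_integrable => //; exact: continuous_mul.
have id : mu.-integrable Omega (EFin \o (fun x => \sum_i pderiv i phi x ^+ 2)).
  apply: continuous_bounded_integrable => //.
  apply: continuous_big => [|i _]; first exact: add_continuous.
  by apply: continuous_mul; exact: smooth_continuous (smooth_pderiv _ sphi).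
have -> : c * \int[mu]_(x in Omega) (phi x ^+ 2) =
    \int[mu]_(x in Omega) (4 * W x + c * phi x ^+ 2).
  have i4W : mu.-integrable Omega (EFin \o (fun x => 4 * W x)).
    by apply: eq_integrable (integrableZl mO 4 iW).
  have icp : mu.-integrable Omega (EFin \o (fun x => c * phi x ^+ 2)).
    by apply: eq_integrable (integrableZl mO c ip).
  by rewrite RintegralD// !RintegralZl// Rintegral_W mulr0 add0r.
apply: le_Rintegral => //.
  have i4W : mu.-integrable Omega (EFin \o (fun x => 4 * W x)).
    by apply: eq_integrable (integrableZl mO 4 iW).
  have icp : mu.-integrable Omega (EFin \o (fun x => c * phi x ^+ 2)).
    by apply: eq_integrable (integrableZl mO c ip).
  by apply: eq_integrable (integrableD mO i4W icp).
move=> x Ox.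
have pm : ord_max != penult :> 'I_n.+2.
  by apply/eqP => /(congr1 val) /=; rewrite penultE => /esym/n_Sn.
rewrite (bigD1 penult)//= (bigD1 ord_max)//= addrA -[leLHS]addr0.
apply: lerD; last by apply: sumr_ge0 => i _; exact: sqr_ge0.
have [_ _ _ ode] := kdk (OSS Ox); rewrite /W /E /euler.
have {}ode : c = - (4 * (rad2 x * dk (rad2 x) + k (rad2 x) + rad2 x * k (rad2 x) ^+ 2)).
  by rewrite ode; field.
rewrite {1}ode -subr_ge0.
set f := phi x; set P := pderiv penult phi x; set Q := pderiv ord_max phi x.
set k0 := k (rad2 x); set dk0 := dk (rad2 x).
(* the difference of the two sides is |grad' phi - phi grad' psi / psi|^2, where
   psi is the ground state and grad' the gradient in the last two variables *)
have -> : P ^+ 2 + Q ^+ 2 - (4 * (f ^+ 2 * k0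
      + f * (penult_coord x * P + last_coord x * Q) * k0 + rad2 x * f ^+ 2 * dk0)
      + - (4 * (rad2 x * dk0 + k0 + rad2 x * k0 ^+ 2)) * f ^+ 2) =
    (P - 2 * k0 * f * penult_coord x) ^+ 2 + (Q - 2 * k0 * f * last_coord x) ^+ 2.
  by rewrite /rad2; ring.
by rewrite addr_ge0// sqr_ge0.
Qed.

End poincare.

(** The ground state J_0(sqrt c |x'|), with x' the last two coordinates, gives the
    inequality with constant c on test functions: its gradient is tangent to the
    faces of the sector, so [Gamma] contributes no boundary term. *)
Theorem poincare_test {R : realType} {n : nat} (beta : R)
    (Omega Gamma : set 'rV[R]_n.+2) (c S : R) (phi : 'rV[R]_n.+2 -> R) :
  open Omega -> bounded_set Omega -> Omega `<=` sector beta ->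
  Gamma `<=` frontier (sector beta) ->
  0 < c -> 0 <= S -> c * S < bessel_j0 ^+ 2 ->
  (forall p, Omega p -> rad2 p <= S) ->
  smooth phi -> supp phi `&` closure Omega `<=` Omega `|` Gamma ->
  c * \int[lebesgue_rV R n.+2]_(x in Omega) (phi x ^+ 2) <=
  \int[lebesgue_rV R n.+2]_(x in Omega) (\sum_i pderiv i phi x ^+ 2).
Proof.
move=> oO bO sO hG c0 S0 cS OS sphi phiO.
have [k [dk [K [mk mdk kdk]]]] := bessel_riccati c0 S0 cS.
exact: (poincare_test_aux oO bO sO hG sphi phiO OS mk mdk kdk).
Qed.

(** * Square-integrable functions *)

Section square_integrable.
Context d (T : measurableType d) (R : realType).
Variables (mu : {measure set T -> \bar R}) (D : set T).
Hypothesis mD : measurable D.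
Implicit Types f g a b : T -> R.

Definition sqint f :=
  measurable_fun D f /\ mu.-integrable D (EFin \o (fun x => f x ^+ 2)).

Lemma integrable_le f g : measurable_fun D f ->
  (forall x, D x -> `|f x| <= g x) -> mu.-integrable D (EFin \o g) ->
  mu.-integrable D (EFin \o f).
Proof.
move=> mf fg ig; apply: le_integrable ig => //; first exact/measurable_EFinP.
by move=> x Dx; rewrite /= lee_fin (le_trans (fg x Dx))// ler_norm.
Qed.

Lemma integrableD_fun f g : mu.-integrable D (EFin \o f) ->
  mu.-integrable D (EFin \o g) -> mu.-integrable D (EFin \o (fun x => f x + g x)).
Proof. by move=> hf hg; apply: eq_integrable (integrableD mD hf hg). Qed.

Lemma integrableB_fun f g : mu.-integrable D (EFin \o f) ->
  mu.-integrable D (EFin \o g) -> mu.-integrable D (EFin \o (fun x => f x - g x)).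
Proof. by move=> hf hg; apply: eq_integrable (integrableB mD hf hg). Qed.

Lemma integrableZ_fun (k : R) f : mu.-integrable D (EFin \o f) ->
  mu.-integrable D (EFin \o (fun x => k * f x)).
Proof. by move=> hf; apply: eq_integrable (integrableZl mD k hf). Qed.

Lemma sqintM f g : sqint f -> sqint g -> mu.-integrable D (EFin \o (fun x => f x * g x)).
Proof.
move=> [mf iff] [mg igg]; apply: (integrable_le _ _ (integrableD_fun iff igg)).
  exact: measurable_funM.
move=> x _; have := sqr_ge0 (f x + g x); have := sqr_ge0 (f x - g x).
have := sqr_ge0 (f x); have := sqr_ge0 (g x).
by rewrite /= ler_norml; move=> *; apply/andP; split; nra.
Qed.

Lemma sqintD f g : sqint f -> sqint g -> sqint (fun x => f x + g x).
Proof.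
move=> [mf iff] [mg igg]; split; first exact: measurable_funD.
apply: (integrable_le _ _ (integrableZ_fun 2 (integrableD_fun iff igg))).
  by apply: measurable_funX; exact: measurable_funD.
move=> x _; rewrite /= ger0_norm ?sqr_ge0//.
have := sqr_ge0 (f x - g x); set u := f x; set v := g x => uv.
nra.
Qed.

Lemma sqint_mul_bounded f g (M : R) : measurable_fun D g ->
  (forall x, D x -> `|g x| <= M) -> sqint f -> sqint (fun x => f x * g x).
Proof.
move=> mg gM [mf iff]; split; first exact: measurable_funM.
apply: (integrable_le _ _ (integrableZ_fun (M ^+ 2) iff)).
  by apply: measurable_funX; exact: measurable_funM.
move=> x Dx; rewrite /= ger0_norm ?sqr_ge0// exprMn mulrC ler_wpM2r ?sqr_ge0//.
by rewrite -(real_normK (num_real (g x))) lerXn2r ?nnegrE ?gM// (le_trans _ (gM x Dx)).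
Qed.

Lemma sqintZ k f : sqint f -> sqint (fun x => k * f x).
Proof.
move=> hf; have := @sqint_mul_bounded f (cst k) `|k| (@measurable_cst _ _ _ _ _ _) (fun _ _ => lexx _) hf.
by under eq_fun do rewrite mulrC.
Qed.

Lemma sqintB f g : sqint f -> sqint g -> sqint (fun x => f x - g x).
Proof.
move=> hf hg; have := sqintD hf (sqintZ (-1) hg).
by under [X in sqint X]eq_fun do rewrite mulN1r.
Qed.

(** Young's inequality in place of Cauchy-Schwarz: enough to pass to the limit. *)
Lemma Rintegral_mul_small a b (e : R) : 0 < e -> sqint a -> sqint b ->
  \int[mu]_(x in D) (b x ^+ 2) <= e ^+ 2 ->
  `|\int[mu]_(x in D) (a x * b x)| <= e * (\int[mu]_(x in D) (a x ^+ 2) + 1).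
Proof.
move=> e0 ha hb be; have [ma iaa] := ha; have [mb ibb] := hb.
have iab := sqintM ha hb.
apply: le_trans (le_normr_Rintegral mD iab) _.
apply: (@le_trans _ _ (\int[mu]_(x in D) (e * a x ^+ 2 + e^-1 * b x ^+ 2))).
  apply: le_Rintegral => //; first exact: integrable_norm.
    exact: integrableD_fun (integrableZ_fun _ iaa) (integrableZ_fun _ ibb).
  move=> x _; rewrite -(ler_pM2l e0) mulrDr mulVKf ?gt_eqF// -[X in `|X|]/(a x * b x).
  have := sqr_ge0 (e * `|a x| - `|b x|); rewrite normrM.
  have := real_normK (num_real (a x)); have := real_normK (num_real (b x)).
  set A := `|a x|; set B := `|b x| => <- <-.
  have A0 : 0 <= A := normr_ge0 _; have B0 : 0 <= B := normr_ge0 _.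
  move: (mulr_ge0 (ltW e0) (mulr_ge0 A0 B0)) => eAB h; nra.
rewrite RintegralD//; [|exact: integrableZ_fun..].
rewrite !RintegralZl// mulrDr mulr1 lerD2l// mulrC ler_pdivrMr// -expr2//.
Qed.

Lemma Rintegral_sqr_le a b : sqint a -> sqint b ->
  (forall x, D x -> `|a x| <= `|b x|) ->
  \int[mu]_(x in D) (a x ^+ 2) <= \int[mu]_(x in D) (b x ^+ 2).
Proof.
move=> [ma ia] [mb ib] ab; apply: le_Rintegral => // x Dx.
by rewrite -(real_normK (num_real (a x))) -(real_normK (num_real (b x))) lerXn2r ?nnegrE ?ab.
Qed.

Lemma ae_eq_Rintegral f g : measurable_fun D f -> measurable_fun D g ->
  {ae mu, forall x, D x -> f x = g x} ->
  \int[mu]_(x in D) f x = \int[mu]_(x in D) g x.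
Proof.
move=> mf mg fg; congr fine; apply: ae_eq_integral => //;
  [exact/measurable_EFinP|exact/measurable_EFinP|].
by apply: filterS fg => x + Dx => /(_ Dx) ->.
Qed.

Lemma ae_Rintegral_ge0 f : measurable_fun D f ->
  {ae mu, forall x, D x -> 0 <= f x} -> 0 <= \int[mu]_(x in D) f x.
Proof.
move=> mf f0; rewrite (@ae_eq_Rintegral f (fun x => `|f x|))//.
- exact: Rintegral_ge0.
- exact: measurableT_comp.
- by apply: filterS f0 => x + Dx => /(_ Dx) /ger0_norm ->.
Qed.

Lemma sqint_LfunP f : (f \_ D \in Lfun mu 2%:E) <-> sqint f.
Proof.
split=> [fL|[mf iff]].
  have mf : measurable_fun setT (f \_ D).
    by move: fL; rewrite inE => /andP[]; rewrite inE.
  split; first exact/(measurable_restrictT _ _).2.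
  have := Lfun2_integrable_sqr fL; rewrite [X in _ -> X]integrable_mkcond//.
  apply: eq_integrable => // x _; rewrite /= !patchE; case: ifP => //= _.
  by rewrite expr0n.
rewrite inE; apply/andP; split; rewrite inE/=; first exact/(measurable_restrictT _ _).1.
rewrite /finite_norm unlock; apply: poweR_lty.
have /integrableP[_] := iff; rewrite integral_mkcond; apply: le_lt_trans.
rewrite le_eqVlt; apply/orP; left; apply/eqP; apply: eq_integral => x _.
rewrite /= !patchE; case: ifP => _; last by rewrite normr0 powR0.
by rewrite powR_mulrn// real_normK ?num_real// ger0_norm ?sqr_ge0.
Qed.

End square_integrable.

(** * Weak derivatives *)

Section weak_derivatives.
Context {R : realType} {n : nat}.
Local Notation mu := (lebesgue_rV R n).
Variable Omega : set 'rV[R]_n.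
Hypotheses (oO : open Omega) (bO : bounded_set Omega).
Implicit Types (u v w f phi eta : 'rV[R]_n -> R) (i : 'I_n).
Local Notation L2 := (sqint mu Omega).

Let mO : measurable Omega := open_measurable_rV oO.

Lemma Lp2P f : Lp Omega 2%:E f <-> L2 f.
Proof. exact: sqint_LfunP. Qed.

Lemma continuous_sqint f : continuous f -> L2 f.
Proof.
move=> cf; split; first exact: continuous_measurable_rV.
by apply: continuous_bounded_integrable => //; exact: continuous_mul.
Qed.

Lemma sqint_integrable f : L2 f -> mu.-integrable Omega (EFin \o f).
Proof.
move=> f2; have := sqintM mO f2 (continuous_sqint (@cst_continuous _ _ (1 : R))).
by under eq_fun do rewrite mulr1.
Qed.

Lemma continuous_sup f : continuous f ->
  exists2 M : R, 0 <= M & forall x, Omega x -> `|f x| <= M.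
Proof.
move=> cf; have [M _ OM] := bounded_box bO.
have [K K0 fK] := continuous_le_on_cbox (fun=> - M) (fun=> M) cf.
by exists K => // x /OM; exact: fK.
Qed.

Lemma sqint_mul_continuous f g : L2 f -> continuous g -> L2 (fun x => f x * g x).
Proof.
move=> f2 cg; have [M _ gM] := continuous_sup cg.
exact: (sqint_mul_bounded mO (continuous_measurable_rV cg) gM f2).
Qed.

Lemma notin_supp f x : ~ supp f x -> f x = 0.
Proof. by move=> fx; apply/eqP; apply: contrapT => /negP h; apply: fx; exact: subset_closure. Qed.

Lemma pderiv_notin_supp f i x : ~ supp f x -> pderiv i f x = 0.
Proof.
move=> fx; rewrite /pderiv -(derive_cst (0 : R) x (delta_mx ord0 i)).
apply: near_eq_derive.
have : nbhs x (~` supp f).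
  by apply: open_nbhs_nbhs; split => //; apply: closed_openC; exact: closed_closure.
by apply: filterS => y /notin_supp.
Qed.

Lemma Ccoo_smooth A phi : Ccoo A phi -> smooth phi. Proof. by case. Qed.

Lemma Ccoo_notin eta x : Ccoo Omega eta -> ~ Omega x -> eta x = 0.
Proof. by move=> [_ _ sO] Ox; apply: notin_supp => /sO. Qed.

Lemma Ccoo_pderiv_notin eta i x : Ccoo Omega eta -> ~ Omega x -> pderiv i eta x = 0.
Proof. by move=> [_ _ sO] Ox; apply: pderiv_notin_supp => /sO. Qed.

Lemma Ccoo_mul f eta : smooth f -> Ccoo Omega eta -> Ccoo Omega (fun x => f x * eta x).
Proof.
move=> sf [se ce sO].
have sub : supp (fun x => f x * eta x) `<=` supp eta.
  by apply: closureS => x /=; apply: contra_neq => ->; rewrite mulr0.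
split; [exact: smoothM| |exact: subset_trans sO].
by apply: subclosed_compact ce sub; exact: closed_closure.
Qed.

(** The product extends by zero to a C^1 function with compact support, whose
    partial derivatives integrate to zero. *)
Lemma Ccoo_by_parts f eta i : continuous f ->
  (forall x, derivable f x (delta_mx ord0 i)) -> continuous (pderiv i f) ->
  Ccoo Omega eta ->
  \int[mu]_(x in Omega) (f x * pderiv i eta x + pderiv i f x * eta x) = 0.
Proof.
move=> cf df cdf eO; have [se _ _] := eO.
pose h x := f x * eta x.
have Dh x : is_derive x (delta_mx ord0 i) h (f x * pderiv i eta x + pderiv i f x * eta x).
  rewrite [_ f x * _]mulrC.
  exact: is_deriveM (derivableP (df x)) (smooth_is_derive i x se).
have Eh : pderiv i h = fun x => f x * pderiv i eta x + pderiv i f x * eta x.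
  by apply/funext => x; have [_] := Dh x.
have [M _ OM] := bounded_box bO.
have := @Rintegral_pderiv_eq0 R n h i M.
rewrite Eh => H; rewrite Rintegral_mkcond -[RHS]H.
- apply: eq_Rintegral => x _; rewrite patchE; case: ifPn => //; rewrite notin_setE => Ox.
  by rewrite (Ccoo_notin eO Ox) (Ccoo_pderiv_notin i eO Ox) !mulr0 addr0.
- exact: continuous_mul cf (smooth_continuous se).
- by move=> x; have [] := Dh x.
- apply: continuous_add; apply: continuous_mul => //.
    exact: smooth_continuous (smooth_pderiv i se).
  exact: smooth_continuous.
- move=> x xM; rewrite /h (Ccoo_notin eO) ?mulr0// => /OM.
  exact: xM.
- move=> x xM; have Ox : ~ Omega x by move=> /OM.
  by rewrite (Ccoo_notin eO Ox) (Ccoo_pderiv_notin i eO Ox) !mulr0 addr0.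
Qed.

Lemma smooth_is_wpderiv phi i : smooth phi -> is_wpderiv Omega i phi (pderiv i phi).
Proof.
move=> sp eta eO; have [se _ _] := eO; apply/eqP; rewrite -subr_eq0 opprK; apply/eqP.
have cp := smooth_continuous sp.
have cdp := smooth_continuous (smooth_pderiv i sp).
rewrite -RintegralD//; last 2 first.
- by apply: sqintM => //; apply: continuous_sqint => //; exact: smooth_continuous (smooth_pderiv i se).
- by apply: sqintM => //; apply: continuous_sqint => //; exact: smooth_continuous se.
by apply: Ccoo_by_parts => // x; have [] := smooth_is_derive i x sp.
Qed.

(** This makes the arbitrary choice behind [wpderiv] harmless. *)
Lemma is_wpderiv_unique i u v v' : L2 v -> L2 v' ->
  is_wpderiv Omega i u v -> is_wpderiv Omega i u v' ->
  {ae mu, forall x, Omega x -> v x = v' x}.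
Proof.
move=> v2 v'2 uv uv'.
have := @fundamental_lemma R n Omega (fun x => v x - v' x) oO
  (sqint_integrable (sqintB mO v2 v'2)).
move=> H; have {}H : {ae mu, forall x, Omega x -> v x - v' x = 0}.
  apply: H => phi pO; have cp := smooth_continuous (Ccoo_smooth pO).
  under eq_Rintegral do rewrite mulrBl.
  rewrite RintegralB//; [|exact: sqintM _ (continuous_sqint cp)..].
  by have := uv _ pO; rewrite (uv' _ pO) => /oppr_inj ->; rewrite subrr.
by apply: filterS H => x h Ox; apply/eqP; rewrite -subr_eq0 h.
Qed.

Lemma is_wpderivB i u v u' v' : L2 u -> L2 v -> L2 u' -> L2 v' ->
  is_wpderiv Omega i u u' -> is_wpderiv Omega i v v' ->
  is_wpderiv Omega i (u \- v)%R (fun x => u' x - v' x).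
Proof.
move=> u2 v2 u'2 v'2 uu' vv' phi pO.
have cp := smooth_continuous (Ccoo_smooth pO).
have cdp := smooth_continuous (smooth_pderiv i (Ccoo_smooth pO)).
under eq_Rintegral do rewrite /= mulrBl.
under [X in - X]eq_Rintegral do rewrite /= mulrBl.
rewrite !RintegralB//; try exact: sqintM _ (continuous_sqint _).
by rewrite uu'// vv'// opprD !opprK.
Qed.

Lemma W12_sqint u : W12 Omega u -> L2 u.
Proof. by move=> [/Lp2P]. Qed.

Lemma wpderivP u i : W12 Omega u ->
  L2 (wpderiv Omega i u) /\ is_wpderiv Omega i u (wpderiv Omega i u).
Proof.
move=> [_ /(_ i)[v v2 uv]].
by have [/Lp2P] := xgetPex (cst 0) (ex_intro [set v | Lp Omega 2%:E v /\ is_wpderiv Omega i u v] v (conj v2 uv)).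
Qed.

Lemma W12_subtest u phi : W12 Omega u -> smooth phi -> W12 Omega (u \- phi)%R.
Proof.
move=> Wu sp; have p2 := continuous_sqint (smooth_continuous sp).
split; first by apply/Lp2P; exact: sqintB (W12_sqint Wu) p2.
move=> i; have [ui2 uui] := wpderivP i Wu.
have dp2 := continuous_sqint (smooth_continuous (smooth_pderiv i sp)).
exists (fun x => wpderiv Omega i u x - pderiv i phi x).
  by apply/Lp2P; exact: sqintB.
apply: is_wpderivB => //; first exact: W12_sqint.
exact: smooth_is_wpderiv.
Qed.

Lemma wpderiv_subtest u phi i : W12 Omega u -> smooth phi ->
  {ae mu, forall x, Omega x ->
     wpderiv Omega i (u \- phi)%R x = wpderiv Omega i u x - pderiv i phi x}.
Proof.
move=> Wu sp; have p2 := continuous_sqint (smooth_continuous sp).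
have [ui2 uui] := wpderivP i Wu.
have dp2 := continuous_sqint (smooth_continuous (smooth_pderiv i sp)).
have [d2 ud] := wpderivP i (W12_subtest Wu sp).
apply: is_wpderiv_unique ud _ => //; first exact: sqintB.
apply: is_wpderivB => //; first exact: W12_sqint.
exact: smooth_is_wpderiv.
Qed.

(** The norm that defines H^1_0 involves chosen representatives of the weak
    derivatives of a difference; uniqueness allows to compute them. *)
Lemma H10_approx Gamma u (e : R) : H10 Omega Gamma u -> 0 < e ->
  exists phi, [/\ smooth phi, supp phi `&` closure Omega `<=` Omega `|` Gamma,
    \int[mu]_(x in Omega) ((u x - phi x) ^+ 2) <= e ^+ 2 &
    forall i, \int[mu]_(x in Omega)
      ((wpderiv Omega i u x - pderiv i phi x) ^+ 2) <= e ^+ 2].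
Proof.
move=> [Wu Hu] e0; have [phi [[sp _ _] _ sG ne]] := Hu e e0.
have ui2 i : L2 (wpderiv Omega i u) by have [] := wpderivP i Wu.
have p2 := continuous_sqint (smooth_continuous sp).
have dp2 i := continuous_sqint (smooth_continuous (smooth_pderiv i sp)).
pose q := (fun x => (u \- phi)%R x ^+ 2 + \sum_(i < n) wpderiv Omega i (u \- phi)%R x ^+ 2).
have b2 : L2 (u \- phi)%R := sqintB mO (W12_sqint Wu) p2.
have bi2 i : L2 (wpderiv Omega i (u \- phi)%R) by have [] := wpderivP i (W12_subtest Wu sp).
have isum : mu.-integrable Omega (EFin \o (fun x => \sum_(i < n) wpderiv Omega i (u \- phi)%R x ^+ 2)).
  rewrite (_ : EFin \o _ = fun x => (\sum_(i < n) (wpderiv Omega i (u \- phi)%R x ^+ 2)%:E)%E).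
    by apply: integrable_sum => // i _; have [] := bi2 i.
  by apply/funext => x; rewrite /= sumEFin.
have iq : mu.-integrable Omega (EFin \o q).
  by apply: integrableD_fun => //; have [] := b2.
have qe : \int[mu]_(x in Omega) q x <= e ^+ 2.
  have q0 : 0 <= \int[mu]_(x in Omega) q x.
    by apply: Rintegral_ge0 => x _; rewrite addr_ge0 ?sqr_ge0// sumr_ge0// => i _; exact: sqr_ge0.
  move: ne; rewrite /W12norm.
  rewrite (_ : (\int[mu]_(x in Omega) _)%E = (\int[mu]_(x in Omega) q x)%:E); last first.
    by rewrite /Rintegral fineK//; exact: integrable_fin_num.
  rewrite poweR_EFin lte_fin powR12_sqrt// => qe.
  rewrite -(sqr_sqrtr q0) lerXn2r ?nnegrE ?sqrtr_ge0 ?(ltW e0)//; exact: ltW.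
exists phi; split => //.
  apply: le_trans qe; apply: le_Rintegral => //; first by have [] := b2.
  by move=> x _; rewrite /q /= lerDl sumr_ge0// => i _; exact: sqr_ge0.
move=> i; rewrite (@ae_eq_Rintegral _ _ _ _ _ mO _ (fun x => wpderiv Omega i (u \- phi)%R x ^+ 2)).
- apply: le_trans qe; apply: le_Rintegral => //; first by have [] := bi2 i.
  move=> x _; rewrite /q /= (bigD1 i)//= addrCA lerDl addr_ge0 ?sqr_ge0//.
  by rewrite sumr_ge0// => j _; exact: sqr_ge0.
- by have [mm _] := sqintB mO (ui2 i) (dp2 i); exact: measurable_funX.
- by have [mm _] := bi2 i; exact: measurable_funX.
- by apply: filterS (wpderiv_subtest i Wu sp) => x h Ox; rewrite h.
Qed.

End weak_derivatives.

(** * A truncation shrinking to zero *)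

Section truncation.
Context {R : realType}.
Implicit Types (t s : R) (k : nat).

Definition trunc_fac k t : R := (1 + k.+1%:R * t ^+ 2)^-1.
(** The truncations t / (1 + (k+1) t^2) tend uniformly to 0, while their
    derivatives stay bounded and tend to the indicator function of 0. *)
Definition trunc k t : R := t * trunc_fac k t.
Definition dtrunc k t : R := 2 * trunc_fac k t ^+ 2 - trunc_fac k t.

Let den k t : R := 1 + k.+1%:R * t ^+ 2.

Let den_ge1 k t : 1 <= den k t.
Proof. by rewrite lerDl mulr_ge0// sqr_ge0. Qed.

Let den_gt0 k t : 0 < den k t.
Proof. exact: lt_le_trans (den_ge1 k t). Qed.

Let den_neq0 k t : den k t != 0.
Proof. by rewrite gt_eqF. Qed.

Lemma trunc_fac_gt0 k t : 0 < trunc_fac k t.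
Proof. by rewrite invr_gt0; exact: den_gt0. Qed.

Lemma trunc_fac_le1 k t : trunc_fac k t <= 1.
Proof. by rewrite invf_le1; [exact: den_ge1|exact: den_gt0]. Qed.

Lemma norm_mul_trunc_fac_le1 k t : `|t| * trunc_fac k t <= 1.
Proof.
rewrite /trunc_fac -/(den k t) ler_pdivrMr// mul1r.
have h := sqr_ge0 (`|t| - 1); have t2 : `|t| ^+ 2 = t ^+ 2 := real_normK (num_real t).
have k1 : t ^+ 2 <= k.+1%:R * t ^+ 2 by rewrite ler_peMl ?sqr_ge0// ler1n.
by rewrite -/(den k t) /den; have t0 := normr_ge0 t; nra.
Qed.

Lemma norm_trunc_le k t : `|trunc k t| <= `|t|.
Proof.
by rewrite normrM (gtr0_norm (trunc_fac_gt0 k t)) ler_piMr// trunc_fac_le1.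
Qed.

Lemma norm_dtrunc_le k t : `|dtrunc k t| <= 1.
Proof.
have h0 := trunc_fac_gt0 k t; have h1 := trunc_fac_le1 k t.
by rewrite /dtrunc ler_norml; move: (trunc_fac k t) h0 h1 => q h0 h1; apply/andP; split; nra.
Qed.

Lemma trunc_fac_lip k t s :
  `|trunc_fac k t - trunc_fac k s| <= 2 * k.+1%:R * `|t - s|.
Proof.
have -> : trunc_fac k t - trunc_fac k s =
    k.+1%:R * (s - t) * (s * trunc_fac k s * trunc_fac k t + t * trunc_fac k t * trunc_fac k s).
  rewrite /trunc_fac -/(den k t) -/(den k s).
  have := den_neq0 k t; have := den_neq0 k s; rewrite /den.
  by move: (k.+1%:R : R) => m h1 h2; field; rewrite h1 h2.
have q1 a b : `|a * trunc_fac k a * trunc_fac k b| <= 1.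
  rewrite !normrM !(gtr0_norm (trunc_fac_gt0 _ _)) mulr_ile1//.
  - by rewrite mulr_ge0// ltW// trunc_fac_gt0.
  - exact/ltW/trunc_fac_gt0.
  - exact: norm_mul_trunc_fac_le1.
  - exact: trunc_fac_le1.
rewrite (normrM (_ * _)) (normrM k.+1%:R) ger0_norm// (distrC s t) (mulrC 2) -!mulrA.
rewrite ler_wpM2l// mulrC ler_wpM2r//.
by apply: le_trans (ler_normD _ _) _; rewrite !mulrA (_ : 2 = 1 + 1 :> R)// lerD.
Qed.

Lemma trunc_lip k t s : `|trunc k t - trunc k s| <= `|t - s|.
Proof.
have -> : trunc k t - trunc k s =
    (t - s) * ((1 - k.+1%:R * (t * s)) * (trunc_fac k s * trunc_fac k t)).
  rewrite /trunc /trunc_fac -/(den k t) -/(den k s).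
  have := den_neq0 k t; have := den_neq0 k s; rewrite /den.
  by move: (k.+1%:R : R) => m h1 h2; field; rewrite h1 h2.
rewrite normrM ler_piMr// normrM (gtr0_norm (mulr_gt0 (trunc_fac_gt0 _ _) (trunc_fac_gt0 _ _))).
rewrite /trunc_fac -/(den k t) -/(den k s) -invfM ler_pdivrMr ?mulr_gt0// mul1r.
rewrite /den ler_norml.
have h1 := mulr_ge0 (ler0n R k.+1) (sqr_ge0 (t - s)).
have h2 := mulr_ge0 (ler0n R k.+1) (sqr_ge0 (t + s)).
have h3 := sqr_ge0 (k.+1%:R * (t * s)).
have h4 := mulr_ge0 (ler0n R k.+1) (sqr_ge0 t).
have h5 := mulr_ge0 (ler0n R k.+1) (sqr_ge0 s).
by move: (k.+1%:R) h1 h2 h3 h4 h5 => m h1 h2 h3 h4 h5; apply/andP; split; nra.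
Qed.

Lemma is_derive_trunc_fac k t :
  is_derive t 1 (trunc_fac k) (- (2 * k.+1%:R * t * trunc_fac k t ^+ 2)).
Proof.
have dd : is_derive t 1 (fun s : R => 1 + k.+1%:R * (s * s)) (2 * k.+1%:R * t).
  have d2 : is_derive t 1 (fun s : R => s * s) (2 * t).
    apply: is_derive_eq (is_deriveM (is_derive_id t 1) (is_derive_id t 1)) _.
    by rewrite /GRing.scale/=; ring.
  have d3 : is_derive t 1 (fun s : R => k.+1%:R * (s * s)) (2 * k.+1%:R * t).
    apply: is_derive_eq (is_deriveM (is_derive_cst (k.+1%:R : R) t 1) d2) _.
    by rewrite /GRing.scale/=; ring.
  apply: is_derive_eq (is_deriveD (is_derive_cst (1 : R) t 1) d3) _.
  by rewrite add0r.
have dn : 1 + k.+1%:R * (t * t) != 0 by rewrite -expr2; exact: den_neq0.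
rewrite (_ : trunc_fac k = fun s => (1 + k.+1%:R * (s * s))^-1); last first.
  by apply/funext => s; rewrite /trunc_fac expr2.
apply: is_derive_eq (is_deriveV (f := fun s => 1 + k.+1%:R * (s * s)) dn dd) _.
by rewrite /GRing.scale/= mulNr mulrC -exprVn.
Qed.

Lemma is_derive_trunc k t : is_derive t 1 (trunc k) (dtrunc k t).
Proof.
apply: is_derive_eq (is_deriveM (is_derive_id t 1) (is_derive_trunc_fac k t)) _.
rewrite /GRing.scale/= /dtrunc /trunc_fac; have := den_neq0 k t; rewrite /den.
by move: (k.+1%:R : R) => m h; field.
Qed.

Lemma trunc_fac_cvg0 t : t != 0 -> trunc_fac k t @[k --> \oo] --> (0 : R).
Proof.
move=> t0; have t20 : 0 < t ^+ 2 by rewrite exprn_even_gt0.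
have b : (t ^+ 2)^-1 * harmonic k @[k --> \oo] --> (0 : R).
  by rewrite -[X in _ --> X](mulr0 (t ^+ 2)^-1); apply: cvgMl_tmp; exact: cvg_harmonic.
apply: (squeeze_cvgr _ (@cvg_cst _ (0 : R) _ _ _) b); apply: nearW => k.
rewrite ltW ?trunc_fac_gt0//= -invfM lef_pV2 ?posrE; [|exact: den_gt0|exact: mulr_gt0].
by rewrite mulrC lerDr.
Qed.

End truncation.

Section limits.
Context {R : realType}.

Lemma le0_of_small (x C : R) : (forall e, 0 < e -> e <= 1 -> x <= e * C) -> x <= 0.
Proof.
move=> h; apply/ler_addgt0Pr => e e0; rewrite add0r.
have C1 : 0 < `|C| + 1 by rewrite ltr_wpDl.
pose d := Num.min 1 (e / (`|C| + 1)).
have d0 : 0 < d by rewrite lt_min ltr01 divr_gt0.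
have d1 : d <= 1 by rewrite ge_min lexx.
have de : d * (`|C| + 1) <= e by rewrite -ler_pdivlMr// ge_min lexx orbT.
apply: le_trans (h _ d0 d1) _; apply: le_trans de.
by rewrite ler_wpM2l ?(ltW d0)// (le_trans (ler_norm C))// lerDl.
Qed.

Lemma eq0_of_small (x C : R) : (forall e, 0 < e -> `|x| <= e * C) -> x = 0.
Proof.
move=> h; apply/eqP; rewrite -normr_le0.
by apply: (@le0_of_small _ C) => e e0 _; exact: h.
Qed.

End limits.

(** * Calculus in H^1_0 *)

Section H10_calculus.
Context {R : realType} {n : nat}.
Local Notation mu := (lebesgue_rV R n).
Variables (Omega Gamma : set 'rV[R]_n).
Hypotheses (oO : open Omega) (bO : bounded_set Omega).
Implicit Types (u v w f phi eta : 'rV[R]_n -> R) (i : 'I_n).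
Local Notation L2 := (sqint mu Omega).

Let mO : measurable Omega := open_measurable_rV oO.

Variable u : 'rV[R]_n -> R.
Hypothesis Hu : H10 Omega Gamma u.

Let Wu : W12 Omega u. Proof. by case: Hu. Qed.
Let u2 : L2 u. Proof. exact: W12_sqint. Qed.
Let ui2 i : L2 (wpderiv Omega i u). Proof. by have [] := wpderivP oO i Wu. Qed.
Let mu_ : measurable_fun Omega u. Proof. by case: u2. Qed.

(** Leibniz rule against an arbitrary W^{1,2} function; it is exact for the
    smooth approximants of [u] since then [phi * eta] is a test function. *)
Lemma weak_leibniz w eta i : W12 Omega w -> Ccoo Omega eta ->
  \int[mu]_(x in Omega) (w x * u x * pderiv i eta x +
    (w x * wpderiv Omega i u x + wpderiv Omega i w x * u x) * eta x) = 0.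
Proof.
move=> Ww eO; have seta := Ccoo_smooth eO.
have [wi2 wwi] := wpderivP oO i Ww; have w2 := W12_sqint oO Ww.
set wi := wpderiv Omega i w in wi2 wwi *; set ui := wpderiv Omega i u.
have ce := smooth_continuous seta.
have cde := smooth_continuous (smooth_pderiv i seta).
have a1 : L2 (fun x => w x * pderiv i eta x) by exact: sqint_mul_continuous.
have a2 : L2 (fun x => w x * eta x) by exact: sqint_mul_continuous.
have a3 : L2 (fun x => wi x * eta x) by exact: sqint_mul_continuous.
apply: (@eq0_of_small _ _ (\int[mu]_(x in Omega) ((w x * pderiv i eta x) ^+ 2) + 1 +
   (\int[mu]_(x in Omega) ((w x * eta x) ^+ 2) + 1) +
   (\int[mu]_(x in Omega) ((wi x * eta x) ^+ 2) + 1))) => e e0.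
have [phi [sp _ b1e b2e]] := H10_approx oO bO Hu e0.
have p2 := continuous_sqint oO bO (smooth_continuous sp).
have dp2 := continuous_sqint oO bO (smooth_continuous (smooth_pderiv i sp)).
have b1 : L2 (fun x => u x - phi x) by exact: sqintB.
have b2 : L2 (fun x => ui x - pderiv i phi x) by apply: sqintB => //; exact: ui2.
have peO := Ccoo_mul sp eO.
have test : \int[mu]_(x in Omega) (w x * phi x * pderiv i eta x +
    (w x * pderiv i phi x + wi x * phi x) * eta x) = 0.
  have := wwi _ peO; have pE : pderiv i (fun x => phi x * eta x) =
      fun x => phi x * pderiv i eta x + pderiv i phi x * eta x.
    by apply/funext => x; have [_] := pderivM i x sp seta.
  rewrite pE => /eqP; rewrite -subr_eq0 opprK -RintegralD//; last 2 first.
  - apply: sqintM => //; apply: continuous_sqint => //; rewrite -pE.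
    exact: smooth_continuous (smooth_pderiv i (smoothM sp seta)).
  - apply: sqintM => //; apply: continuous_sqint => //.
    exact: smooth_continuous (smoothM sp seta).
  by move=> /eqP H; rewrite -[RHS]H; apply: eq_Rintegral => x _; ring.
have i1 := sqintM mO a1 b1; have i2 := sqintM mO a2 b2; have i3 := sqintM mO a3 b1.
have itest : mu.-integrable Omega (EFin \o (fun x => w x * phi x * pderiv i eta x +
    (w x * pderiv i phi x + wi x * phi x) * eta x)).
  have := integrableD_fun mO (integrableD_fun mO (sqintM mO a1 p2) (sqintM mO a2 dp2))
    (sqintM mO a3 p2).
  by apply: eq_integrable => // x _ /=; congr EFin; ring.
have -> : \int[mu]_(x in Omega) (w x * u x * pderiv i eta x +
    (w x * ui x + wi x * u x) * eta x) =
   \int[mu]_(x in Omega) ((w x * pderiv i eta x) * (u x - phi x)) +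
   \int[mu]_(x in Omega) ((w x * eta x) * (ui x - pderiv i phi x)) +
   \int[mu]_(x in Omega) ((wi x * eta x) * (u x - phi x)).
  rewrite -[LHS]subr0 -[X in _ - X]test -RintegralB//.
    rewrite -!RintegralD//; last exact: integrableD_fun.
    by apply: eq_Rintegral => x _; ring.
  have := integrableD_fun mO (integrableD_fun mO (sqintM mO a1 u2) (sqintM mO a2 (ui2 i)))
    (sqintM mO a3 u2).
  by apply: eq_integrable => // x _ /=; congr EFin; rewrite /ui; ring.
rewrite [leRHS]mulrDr; apply: le_trans (ler_normD _ _) (lerD _ _).
  rewrite [leRHS]mulrDr.
  apply: le_trans (ler_normD _ _) (lerD _ _).
    exact: (Rintegral_mul_small mO e0 a1 b1 b1e).
  exact: (Rintegral_mul_small mO e0 a2 b2 (b2e i)).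
exact: (Rintegral_mul_small mO e0 a3 b1 b1e).
Qed.

Lemma continuous_trunc_fac k : continuous (@trunc_fac R k).
Proof.
move=> t; apply/differentiable_continuous/derivable1_diffP.
by have [] := is_derive_trunc_fac k t.
Qed.

Lemma continuous_trunc k : continuous (@trunc R k).
Proof.
move=> t; apply/differentiable_continuous/derivable1_diffP.
by have [] := is_derive_trunc k t.
Qed.

Lemma continuous_dtrunc k : continuous (@dtrunc R k).
Proof.
have cq := @continuous_trunc_fac k.
rewrite (_ : dtrunc k = fun t => 2 * (trunc_fac k t * trunc_fac k t) + -1 * trunc_fac k t).
  have cc (c : R) : continuous (cst c : R -> R) by exact: cst_continuous.
  exact: continuous_add (continuous_mul (cc 2) (continuous_mul cq cq)) (continuous_mul (cc (-1)) cq).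
by apply/funext => t; rewrite /dtrunc; ring.
Qed.

Lemma is_derive_comp_dir (G : R -> R) f (x v : 'rV[R]_n) (a b : R) :
  is_derive (f x) 1 G a -> is_derive x v f b -> is_derive x v (fun y => G (f y)) (a * b).
Proof.
move=> HG /is_derive_line0 Hf; apply/is_derive_line0.
by apply: (is_derive1_comp (f := G) (g := fun s => f (x + s *: v))); rewrite ?scale0r ?addr0.
Qed.

Lemma dtrunc_lip k (t s : R) : `|dtrunc k t - dtrunc k s| <= 6 * k.+1%:R * `|t - s|.
Proof.
have -> : dtrunc k t - dtrunc k s =
    (trunc_fac k t - trunc_fac k s) * (2 * (trunc_fac k t + trunc_fac k s) - 1).
  by rewrite /dtrunc; ring.
rewrite (_ : 6 * _ * _ = 2 * k.+1%:R * `|t - s| * 3); last by ring.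
rewrite normrM ler_pM// ?trunc_fac_lip//.
have := trunc_fac_gt0 k t; have := trunc_fac_gt0 k s.
have := trunc_fac_le1 k t; have := trunc_fac_le1 k s.
by rewrite ler_norml => *; apply/andP; split; lra.
Qed.

(** On the smooth approximants of [u] this is integration by parts. Since the
    truncation and its derivative are Lipschitz, the error is linear in the
    distances of [u] and its weak derivative to their approximants. *)
Lemma weak_trunc k eta i : Ccoo Omega eta ->
  \int[mu]_(x in Omega) (trunc k (u x) * pderiv i eta x +
    dtrunc k (u x) * wpderiv Omega i u x * eta x) = 0.
Proof.
move=> eO; have seta := Ccoo_smooth eO.
set ui := wpderiv Omega i u.
have ce := smooth_continuous seta.
have cde := smooth_continuous (smooth_pderiv i seta).
have mt f : measurable_fun Omega f -> measurable_fun Omega (fun x => trunc k (f x)).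
  move=> mf; apply: measurableT_comp => //.
  by apply: continuous_measurable_fun; exact: continuous_trunc.
have md f : measurable_fun Omega f -> measurable_fun Omega (fun x => dtrunc k (f x)).
  move=> mf; apply: measurableT_comp => //.
  by apply: continuous_measurable_fun; exact: continuous_dtrunc.
have t2 f : L2 f -> L2 (fun x => trunc k (f x)).
  move=> f2; have [mf iff] := f2; split; first exact: mt.
  apply: (integrable_le mO _ _ iff); first by apply: measurable_funX; exact: mt.
  move=> x _; rewrite ger0_norm ?sqr_ge0//.
  by rewrite -(real_normK (num_real (trunc _ _))) -(real_normK (num_real (f x))) lerXn2r ?nnegrE// norm_trunc_le.
(* a Lipschitz constant of [dtrunc k] *)
pose L : R := 6 * k.+1%:R.
have a1 : L2 (pderiv i eta) by exact: continuous_sqint.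
have a2 : L2 eta by exact: continuous_sqint.
have a3 : L2 (fun x => L * (ui x * eta x)).
  by apply: sqintZ => //; apply: sqint_mul_continuous => //; exact: ui2.
apply: (@eq0_of_small _ _ (\int[mu]_(x in Omega) ((pderiv i eta x) ^+ 2) + 1 +
   (\int[mu]_(x in Omega) (eta x ^+ 2) + 1) +
   (\int[mu]_(x in Omega) ((L * (ui x * eta x)) ^+ 2) + 1))) => e e0.
have [phi [sp _ b1e b2e]] := H10_approx oO bO Hu e0.
have cp := smooth_continuous sp.
have p2 := continuous_sqint oO bO cp.
have dp2 := continuous_sqint oO bO (smooth_continuous (smooth_pderiv i sp)).
have b1 : L2 (fun x => u x - phi x) by exact: sqintB.
have b2 : L2 (fun x => ui x - pderiv i phi x) by apply: sqintB => //; exact: ui2.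
have [mphi _] := p2.
have c1 : L2 (fun x => trunc k (u x) - trunc k (phi x)).
  by apply: sqintB => //; exact: t2.
have c1e : \int[mu]_(x in Omega) ((trunc k (u x) - trunc k (phi x)) ^+ 2) <= e ^+ 2.
  by apply: le_trans b1e; apply: Rintegral_sqr_le => // x _; exact: trunc_lip.
have c2 : L2 (fun x => (ui x - pderiv i phi x) * dtrunc k (phi x)).
  by apply: (@sqint_mul_bounded _ _ _ _ _ mO _ _ 1) => //; [exact: md|move=> x _; exact: norm_dtrunc_le].
have c2e : \int[mu]_(x in Omega) (((ui x - pderiv i phi x) * dtrunc k (phi x)) ^+ 2) <= e ^+ 2.
  apply: le_trans (b2e i); apply: Rintegral_sqr_le => // x _.
  by rewrite normrM ler_piMr// norm_dtrunc_le.
have L0 : 0 < L by rewrite mulr_gt0.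
have c3 : L2 (fun x => L^-1 * (dtrunc k (u x) - dtrunc k (phi x))).
  split; first by apply: measurable_funM => //; apply: measurable_funB; exact: md.
  have [mb ib] := b1; apply: (integrable_le mO _ _ ib).
    by apply: measurable_funX; apply: measurable_funM => //; apply: measurable_funB; exact: md.
  move=> x _; rewrite ger0_norm ?sqr_ge0//.
  rewrite -(real_normK (num_real (_ * _))) -(real_normK (num_real (u x - phi x))).
  by rewrite lerXn2r ?nnegrE// normrM gtr0_norm ?invr_gt0// ler_pdivrMl// dtrunc_lip.
have c3e : \int[mu]_(x in Omega) ((L^-1 * (dtrunc k (u x) - dtrunc k (phi x))) ^+ 2) <= e ^+ 2.
  apply: le_trans b1e; apply: Rintegral_sqr_le => // x _.
  by rewrite normrM gtr0_norm ?invr_gt0// ler_pdivrMl// dtrunc_lip.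
have Dp x : is_derive x (delta_mx ord0 i) (fun y => trunc k (phi y))
    (dtrunc k (phi x) * pderiv i phi x).
  apply: is_derive_comp_dir; first exact: is_derive_trunc.
  exact: smooth_is_derive.
have Ep : pderiv i (fun y => trunc k (phi y)) = fun x => dtrunc k (phi x) * pderiv i phi x.
  by apply/funext => x; have [_] := Dp x.
have cdt : continuous (fun x => dtrunc k (phi x)).
  by move=> x; apply: continuous_comp; [exact: cp|exact: continuous_dtrunc].
have cdp : continuous (fun x => dtrunc k (phi x) * pderiv i phi x).
  by apply: continuous_mul => //; exact: smooth_continuous (smooth_pderiv i sp).
have test : \int[mu]_(x in Omega) (trunc k (phi x) * pderiv i eta x +
    dtrunc k (phi x) * pderiv i phi x * eta x) = 0.
  have := @Ccoo_by_parts R n Omega bO (fun x => trunc k (phi x)) eta i.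
  rewrite Ep; apply => //.
    by move=> x; apply: continuous_comp; [exact: cp|exact: continuous_trunc].
have du2 : L2 (fun x => ui x * dtrunc k (u x)).
  by apply: (@sqint_mul_bounded _ _ _ _ _ mO _ _ 1) => //;
    [exact: md|move=> x _; exact: norm_dtrunc_le|exact: ui2].
have itest : mu.-integrable Omega (EFin \o (fun x => trunc k (phi x) * pderiv i eta x +
    dtrunc k (phi x) * pderiv i phi x * eta x)).
  have := integrableD_fun mO (sqintM mO (t2 _ p2) a1) (sqintM mO (continuous_sqint oO bO cdp) a2).
  by apply: eq_integrable => // x _.
have iu : mu.-integrable Omega (EFin \o (fun x => trunc k (u x) * pderiv i eta x +
    dtrunc k (u x) * ui x * eta x)).
  have := integrableD_fun mO (sqintM mO (t2 _ u2) a1) (sqintM mO du2 a2).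
  by apply: eq_integrable => // x _ /=; congr EFin; ring.
have i1 := sqintM mO a1 c1; have i2 := sqintM mO a2 c2; have i3 := sqintM mO a3 c3.
have -> : \int[mu]_(x in Omega) (trunc k (u x) * pderiv i eta x +
    dtrunc k (u x) * ui x * eta x) =
   \int[mu]_(x in Omega) (pderiv i eta x * (trunc k (u x) - trunc k (phi x))) +
   \int[mu]_(x in Omega) (eta x * ((ui x - pderiv i phi x) * dtrunc k (phi x))) +
   \int[mu]_(x in Omega) (L * (ui x * eta x) * (L^-1 * (dtrunc k (u x) - dtrunc k (phi x)))).
  rewrite -[LHS]subr0 -[X in _ - X]test -RintegralB//.
  rewrite -!RintegralD//; last exact: integrableD_fun.
  by apply: eq_Rintegral => x _; field; rewrite gt_eqF.
rewrite [leRHS]mulrDr; apply: le_trans (ler_normD _ _) (lerD _ _).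
  rewrite [leRHS]mulrDr.
  apply: le_trans (ler_normD _ _) (lerD _ _).
    exact: (Rintegral_mul_small mO e0 a1 c1 c1e).
  exact: (Rintegral_mul_small mO e0 a2 c2 c2e).
exact: (Rintegral_mul_small mO e0 a3 c3 c3e).
Qed.

(** Limit k -> oo in [weak_trunc]: the truncations of [u] tend to 0, so the
    gradient of [u] times the indicator function of u = 0 is orthogonal to all
    test functions. *)
Lemma wpderiv_eq0_on_zero_set i :
  {ae mu, forall x, Omega x -> u x = 0 -> wpderiv Omega i u x = 0}.
Proof.
pose z x : R := \1_[set (0 : R)] (u x).
have mz : measurable_fun Omega z.
  by apply: measurableT_comp => //; exact: measurable_indic.
pose f x := wpderiv Omega i u x * z x.
have z1 x : `|z x| <= 1 by rewrite /z indicE; case: (_ \in _); rewrite ?normr1 ?normr0.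
have f2 : L2 f.
  by apply: (@sqint_mul_bounded _ _ _ _ _ mO _ _ 1) => //; exact: ui2.
have := @fundamental_lemma R n Omega f oO (sqint_integrable oO bO f2).
move=> H; have {}H : {ae mu, forall x, Omega x -> f x = 0}.
  apply: H => eta eO.
  have seta := Ccoo_smooth eO.
  have ce := smooth_continuous seta.
  have cde := smooth_continuous (smooth_pderiv i seta).
  have e2 : L2 eta by exact: continuous_sqint.
  have de2 : L2 (pderiv i eta) by exact: continuous_sqint.
  have [me _] := e2; have [mde _] := de2; have [mui _] := ui2 i; have [mf _] := f2.
  suff : \int[mu]_(x in Omega) (trunc k (u x) * pderiv i eta x +
      dtrunc k (u x) * wpderiv Omega i u x * eta x) @[k --> \oo] -->
      \int[mu]_(x in Omega) (f x * eta x).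
    move=> /(cvg_lim (@Rhausdorff R)) <-; apply: (cvg_lim (@Rhausdorff R)).
    by apply: (cvg_near_cst 0); apply: nearW => k; exact: weak_trunc.
  apply: (Rintegral_dominated (g := fun x =>
      `|u x * pderiv i eta x| + `|wpderiv Omega i u x * eta x|)) => //.
  - move=> k; apply: measurable_funD; apply: measurable_funM => //.
      apply: measurableT_comp => //.
      by apply: continuous_measurable_fun; exact: continuous_trunc.
    apply: measurable_funM => //; apply: measurableT_comp => //.
    by apply: continuous_measurable_fun; exact: continuous_dtrunc.
  - exact: measurable_funM.
  - move=> x _; rewrite [X in _ --> X](_ : _ =
        0 * pderiv i eta x + z x * wpderiv Omega i u x * eta x); last first.
      by rewrite /f; ring.
    have [u0|u0] := eqVneq (u x) 0.
      apply: cvg_near_cst; apply: nearW => k; rewrite u0 /z u0 indicE mem_set//.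
      have q1 : trunc_fac k (0 : R) = 1 by rewrite /trunc_fac expr0n/= mulr0 addr0 invr1.
      by rewrite /trunc /dtrunc q1 /=; ring.
    have q0 := @trunc_fac_cvg0 R _ u0.
    have z0 : z x = 0 by rewrite /z indicE memNset// => /eqP; exact/negP.
    apply: cvgD; apply: cvgMr_tmp.
      rewrite -[X in _ --> X](mulr0 (u x)); apply: cvgMl_tmp; exact: q0.
    apply: cvgMr_tmp; rewrite z0.
    rewrite [X in _ --> X](_ : 0 = 2 * (0 * 0) - 0 :> R); last by ring.
    apply: cvgB; last exact: q0.
    by apply: cvgMl_tmp; rewrite -expr2; apply: cvgM; exact: q0.
  - by apply: integrableD_fun => //; apply: integrable_norm; exact: sqintM.
  - move=> k x _; apply: le_trans (ler_normD _ _) (lerD _ _).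
      by rewrite normrM [leRHS]normrM ler_wpM2r// norm_trunc_le.
    rewrite normrM (normrM (dtrunc _ _)) [leRHS]normrM ler_wpM2r//.
    by rewrite ler_piMl// norm_dtrunc_le.
apply: filterS H => x + Ox u0 => /(_ Ox).
by rewrite /f /z u0 indicE mem_set// mulr1.
Qed.

End H10_calculus.

(** * Energy inequalities and the maximum principle *)

Section energy.
Context {R : realType} {n : nat}.
Local Notation mu := (lebesgue_rV R n).
Variables (Omega Gamma : set 'rV[R]_n).
Hypotheses (oO : open Omega) (bO : bounded_set Omega).
Local Notation L2 := (sqint mu Omega).

Let mO : measurable Omega := open_measurable_rV oO.

Lemma Rintegral_sum (I : Type) (r : seq I) (F : I -> 'rV[R]_n -> R) :
  (forall i, mu.-integrable Omega (EFin \o F i)) ->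
  mu.-integrable Omega (EFin \o (fun x => \sum_(i <- r) F i x)) /\
  \int[mu]_(x in Omega) (\sum_(i <- r) F i x) = \sum_(i <- r) \int[mu]_(x in Omega) F i x.
Proof.
move=> iF; elim: r => [|i r [ir IH]].
  have E : (fun x : 'rV[R]_n => \sum_(i <- [::]) F i x) = cst 0.
    by apply/funext => x; rewrite big_nil.
  rewrite E big_nil; split; first exact: integrable0.
  by rewrite /Rintegral integral0.
have E : (fun x => \sum_(j <- i :: r) F j x) = fun x => F i x + \sum_(j <- r) F j x.
  by apply/funext => x; rewrite big_cons.
by rewrite E big_cons -IH; split; [exact: integrableD_fun|exact: RintegralD].
Qed.

(** Both sides are continuous for the convergence that defines H^1_0. *)
Lemma poincare_H10 (c : R) (u : 'rV[R]_n -> R) : 0 < c -> H10 Omega Gamma u ->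
  (forall phi, smooth phi -> supp phi `&` closure Omega `<=` Omega `|` Gamma ->
    c * \int[mu]_(x in Omega) (phi x ^+ 2) <=
    \int[mu]_(x in Omega) (\sum_i pderiv i phi x ^+ 2)) ->
  c * \int[mu]_(x in Omega) (u x ^+ 2) <=
  \int[mu]_(x in Omega) (\sum_i wpderiv Omega i u x ^+ 2).
Proof.
move=> c0 Hu test; have [Wu _] := Hu; have u2 := W12_sqint oO Wu.
have ui2 i : L2 (wpderiv Omega i u) by have [] := wpderivP oO i Wu.
have [_ ->] := @Rintegral_sum _ (index_enum 'I_n) _ (fun i => (ui2 i).2).
set A := \int[mu]_(x in Omega) (u x ^+ 2).
pose B i := \int[mu]_(x in Omega) (wpderiv Omega i u x ^+ 2).
rewrite -/(\sum_i B i) -subr_le0.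
apply: (@le0_of_small _ _ (c * (2 * (A + 1)) + \sum_(i < n) (2 * (B i + 1) + 1))) => e e0 e1.
have [phi [sp sG b1e b2e]] := H10_approx oO bO Hu e0.
have cp := smooth_continuous sp.
have p2 := continuous_sqint oO bO cp.
have dp2 i := continuous_sqint oO bO (smooth_continuous (smooth_pderiv i sp)).
have sqr_expand (a b : 'rV[R]_n -> R) : L2 a -> L2 b ->
    \int[mu]_(x in Omega) (b x ^+ 2) = \int[mu]_(x in Omega) (a x ^+ 2)
      - 2 * \int[mu]_(x in Omega) (a x * (a x - b x))
      + \int[mu]_(x in Omega) ((a x - b x) ^+ 2).
  move=> a2 b2; have d2 := sqintB mO a2 b2.
  have i1 := a2.2; have i2 := sqintM mO a2 d2; have i3 := d2.2.
  rewrite -RintegralZl// -RintegralB//; last exact: integrableZ_fun.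
  rewrite -RintegralD//; last by apply: integrableB_fun => //; exact: integrableZ_fun.
  by apply: eq_Rintegral => x _; ring.
have phi_ge : A - 2 * (e * (A + 1)) <= \int[mu]_(x in Omega) (phi x ^+ 2).
  rewrite (sqr_expand u phi)//.
  have := Rintegral_mul_small mO e0 u2 (sqintB mO u2 p2) b1e; rewrite ler_norml => /andP[_ h].
  have : 0 <= \int[mu]_(x in Omega) ((u x - phi x) ^+ 2).
    by apply: Rintegral_ge0 => x _; exact: sqr_ge0.
  move: h; rewrite -/A; lra.
have dphi_le i : \int[mu]_(x in Omega) (pderiv i phi x ^+ 2) <=
    B i + e * (2 * (B i + 1) + 1).
  rewrite (sqr_expand (wpderiv Omega i u) (pderiv i phi))//.
  have := Rintegral_mul_small mO e0 (ui2 i) (sqintB mO (ui2 i) (dp2 i)) (b2e i).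
  rewrite ler_norml => /andP[h _]; have := b2e i.
  have ee : e ^+ 2 <= e by rewrite expr2 ler_piMr// ltW.
  move: h; rewrite -/(B i); lra.
have := test phi sp sG.
have [_ ->] := @Rintegral_sum _ (index_enum 'I_n) _ (fun i => (dp2 i).2).
move=> tphi; have t1 := ler_wpM2l (ltW c0) phi_ge.
have t2 : \sum_i \int[mu]_(x in Omega) (pderiv i phi x ^+ 2) <=
    \sum_i B i + e * \sum_(i < n) (2 * (B i + 1) + 1).
  by rewrite mulr_sumr -big_split/=; apply: ler_sum => i _; exact: dphi_le.
move: t1 t2 tphi; set s1 := \sum_i _; set s2 := \sum_i B i; set s3 := \sum_(i < n) _.
by move=> *; nra.
Qed.

End energy.

Lemma Lnorm_oo_ae d (T : measurableType d) (R : realType)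
    (mu : {measure set T -> \bar R}) (f : T -> R) (c0 : R) :
  0 < c0 -> ('N[mu]_+oo[EFin \o f] < c0%:E)%E ->
  exists2 C : R, 0 <= C < c0 & {ae mu, forall x, `|f x| <= C}.
Proof.
move=> c00; rewrite unlock; case: ifPn => [mu0 h|].
  have fC := ess_sup_ge mu (abse \o (EFin \o f)).
  have h0 : (0 <= ess_sup mu (abse \o (EFin \o f)))%E.
    by apply: ess_sup_gee => //; apply: aeW => x; exact: abse_ge0.
  exists (fine (ess_sup mu (abse \o (EFin \o f)))).
    rewrite fine_ge0//= -lte_fin fineK// ge0_fin_numE//.
    exact: lt_trans h (ltry _).
  apply: filterS fC => x; rewrite /= -lee_fin fineK// ge0_fin_numE//.
  exact: lt_trans h (ltry _).
rewrite -leNgt => mu0 _; exists 0; first by rewrite lexx.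
apply: (@negligibleS _ _ _ mu setT) => //.
by apply/negligibleP => //; apply/eqP; rewrite eq_le mu0 measure_ge0.
Qed.

Section final_steps.
Context {R : realType} {n : nat}.
Local Notation mu := (lebesgue_rV R n).
Variables (Omega Gamma : set 'rV[R]_n).
Hypotheses (oO : open Omega) (bO : bounded_set Omega).
Local Notation L2 := (sqint mu Omega).

Let mO : measurable Omega := open_measurable_rV oO.

Lemma integrable_ae_le (f g : 'rV[R]_n -> R) : measurable_fun Omega f ->
  {ae mu, forall x, Omega x -> `|f x| <= g x} ->
  mu.-integrable Omega (EFin \o g) -> mu.-integrable Omega (EFin \o f).
Proof.
move=> mf fg /integrableP[/measurable_EFinP mg goo]; apply/integrableP.
split; first exact/measurable_EFinP.
apply: le_lt_trans goo; apply: ae_ge0_le_integral => //.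
- by apply: measurableT_comp => //; exact/measurable_EFinP.
- by apply: measurableT_comp => //; exact/measurable_EFinP.
by apply: filterS fg => x h Ox; rewrite lee_fin; apply: le_trans (h Ox) (ler_norm _).
Qed.

Lemma mul_funrpos (w : 'rV[R]_n -> R) x : w x * w^\+%R x = w^\+%R x * w^\+%R x.
Proof. by rewrite /funrpos /= maxEle; case: ifP; rewrite ?mulr0. Qed.

(** The products w u and u^2 coincide for u = w^+, so their weak gradients do:
    w grad u + u grad w = 2 u grad u. On u <> 0 this gives grad w = grad u, and
    on u = 0 the gradient of u vanishes. *)
Lemma wpderiv_mul_funrpos (w : 'rV[R]_n -> R) i : W12 Omega w -> H10 Omega Gamma w^\+%R ->
  {ae mu, forall x, Omega x ->
    wpderiv Omega i w x * wpderiv Omega i w^\+%R x = wpderiv Omega i w^\+%R x ^+ 2}.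
Proof.
set u := w^\+%R => Ww Hu; have [Wu _] := Hu.
have [wi2 _] := wpderivP oO i Ww; have [ui2 _] := wpderivP oO i Wu.
have w2 := W12_sqint oO Ww; have u2 := W12_sqint oO Wu.
set wi := wpderiv Omega i w in wi2 *; set ui := wpderiv Omega i u in ui2 *.
pose f x := w x * ui x + wi x * u x - (u x * ui x + ui x * u x).
have if_ : mu.-integrable Omega (EFin \o f).
  by apply: integrableB_fun => //; apply: integrableD_fun => //; exact: sqintM.
have f0 : {ae mu, forall x, Omega x -> f x = 0}.
  apply: fundamental_lemma => // eta eO.
  have seta := Ccoo_smooth eO.
  have ce := smooth_continuous seta.
  have cde := smooth_continuous (smooth_pderiv i seta).
  have H v : W12 Omega v -> mu.-integrable Omega (EFin \o (fun x =>
      v x * u x * pderiv i eta x + (v x * ui x + wpderiv Omega i v x * u x) * eta x)).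
    move=> Wv; have v2 := W12_sqint oO Wv; have [vi2 _] := wpderivP oO i Wv.
    have := integrableD_fun mO (sqintM mO (sqint_mul_continuous oO bO v2 cde) u2)
      (integrableD_fun mO (sqintM mO (sqint_mul_continuous oO bO v2 ce) ui2)
        (sqintM mO (sqint_mul_continuous oO bO vi2 ce) u2)).
    by apply: eq_integrable => // x _ /=; congr EFin; ring.
  have lw := weak_leibniz oO bO Hu i Ww eO; have lu := weak_leibniz oO bO Hu i Wu eO.
  rewrite -[RHS]subr0 -[X in X - _]lw -[X in _ - X]lu -RintegralB//; [|exact: H..].
  by apply: eq_Rintegral => x _; rewrite mul_funrpos /f -/u -/ui -/wi; ring.
have z := wpderiv_eq0_on_zero_set oO bO Hu i.
apply: filterS2 f0 z => x fx zx Ox.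
have [u0|u0] := eqVneq (u x) 0; first by have ui0 : ui x = 0 := zx Ox u0; rewrite ui0 mulr0 expr0n.
have wu : w x = u x by apply: (mulIf u0); exact: mul_funrpos.
have : (wi x - ui x) * u x = 0 by rewrite -(fx Ox) /f wu; ring.
by move/eqP; rewrite mulf_eq0 (negbTE u0) orbF subr_eq0 => /eqP ->; rewrite expr2.
Qed.

(** Testing the inequality with w^+ itself. *)
Lemma energy_le (c w : 'rV[R]_n -> R) (C : R) :
  Lp Omega +oo%E c -> {ae mu, forall x, `|(c^\+%R \_ Omega) x| <= C} ->
  weak_mixed_subsolution Omega Gamma c w ->
  \int[mu]_(x in Omega) (\sum_i wpderiv Omega i w^\+%R x ^+ 2) <=
  C * \int[mu]_(x in Omega) (w^\+%R x ^+ 2).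
Proof.
move=> cL cC [Ww Hu /(_ _ Hu)]; set u := w^\+%R in Hu * => weak; have [Wu _] := Hu.
have {weak} := weak (aeW _ (fun x _ => funrpos_ge0 w x)).
have w2 := W12_sqint oO Ww; have u2 := W12_sqint oO Wu.
have wi2 i : L2 (wpderiv Omega i w) by have [] := wpderivP oO i Ww.
have ui2 i : L2 (wpderiv Omega i u) by have [] := wpderivP oO i Wu.
have [_ ->] := @Rintegral_sum _ _ _ oO _ (index_enum 'I_n) _ (fun i => sqintM mO (wi2 i) (ui2 i)).
have [_ ->] := @Rintegral_sum _ _ _ oO _ (index_enum 'I_n) _ (fun i => (ui2 i).2).
under eq_bigr => i _.
  rewrite (@ae_eq_Rintegral _ _ _ _ _ mO _ (fun x => wpderiv Omega i u x ^+ 2)); last 3 first.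
  - by have [m1 _] := wi2 i; have [m2 _] := ui2 i; exact: measurable_funM.
  - by have [m2 _] := ui2 i; exact: measurable_funX.
  - exact: wpderiv_mul_funrpos.
  over.
rewrite subr_le0 => h; apply: le_trans h _.
have mc : measurable_fun Omega c.
  apply/(measurable_restrictT _ _).2 => //.
  by move: cL; rewrite /Lp /= inE => /andP[]; rewrite inE.
have [Cb _ cb] : exists2 Cb : R, 0 <= Cb < Cb + 1 & {ae mu, forall x, `|(c \_ Omega) x| <= Cb}.
  move: cL; rewrite /Lp /= inE => /andP[_]; rewrite inE /= /finite_norm => Noo.
  have N0 := Lnorm_ge0 mu +oo%E (EFin \o c \_ Omega).
  have [||C' /andP[C'0 _] hC'] := @Lnorm_oo_ae _ _ _ mu (c \_ Omega)
    (fine ('N[mu]_+oo[EFin \o c \_ Omega])%E + 1).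
  - by rewrite ltr_wpDl// fine_ge0.
  - by rewrite EFinD fineK ?ge0_fin_numE// lteDl ?lte_fin// ge0_fin_numE.
  - by exists C' => //; rewrite C'0 ltrDl ltr01.
have mcwu : measurable_fun Omega (fun x => c x * w x * u x).
  by have [? _] := w2; have [? _] := u2; apply: measurable_funM => //; exact: measurable_funM.
have icwu : mu.-integrable Omega (EFin \o (fun x => c x * w x * u x)).
  apply: (@integrable_ae_le _ (fun x => Cb * u x ^+ 2)) => //.
    apply: filterS cb => x + Ox; rewrite patchE mem_set// => h.
    by rewrite -mulrA mul_funrpos -expr2 normrM (ger0_norm (sqr_ge0 _)) ler_wpM2r ?sqr_ge0.
  by apply: integrableZ_fun => //; have [] := u2.
have iu : mu.-integrable Omega (EFin \o (fun x => C * u x ^+ 2)).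
  by apply: integrableZ_fun => //; have [] := u2.
rewrite -RintegralZl//; last by have [] := u2.
rewrite -subr_ge0 -RintegralB//; apply: ae_Rintegral_ge0 => //.
  by apply: measurable_funB => //; have /integrableP[/measurable_EFinP] := iu.
apply: filterS cC => x + Ox; rewrite patchE mem_set// => h.
rewrite subr_ge0 -mulrA mul_funrpos -expr2 ler_wpM2r ?sqr_ge0//.
apply: le_trans (le_trans (ler_norm _) h).
by rewrite /funrpos le_max lexx.
Qed.

Lemma Rintegral_sqr_eq0 (u : 'rV[R]_n -> R) : L2 u ->
  \int[mu]_(x in Omega) (u x ^+ 2) <= 0 -> {ae mu, forall x, Omega x -> u x = 0}.
Proof.
move=> [mu_ iu] I0; have E : (\int[mu]_(x in Omega) `|(u x ^+ 2)%:E| = 0)%E.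
  under eq_integral do rewrite gee0_abs ?lee_fin ?sqr_ge0//.
  have := integrable_fin_num mO iu; move/fineK => <-; congr EFin.
  by apply/eqP; rewrite eq_le I0 Rintegral_ge0// => x _; exact: sqr_ge0.
have mu2 : measurable_fun Omega (fun x => (u x ^+ 2)%:E).
  by apply/measurable_EFinP; exact: measurable_funX.
have := (ae_eq_integral_abs mu mO mu2).1 E.
apply: filterS => x + Ox => /(_ Ox) /= [] /eqP.
by rewrite sqrf_eq0 => /eqP.
Qed.

End final_steps.

Unset Implicit Arguments.
Set Strict Implicit.

(* [n] is the dimension minus 2: the ambient space is R^(n+2). *)
Theorem lemma2p3 (R : realType) (n : nat) (beta : R)
    (hbeta : 0 < beta < 2 * pi)
    (Omega Gamma1 : set 'rV[R]_n.+2)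
    (hOmega : bounded_domain Omega)
    (hsector : Omega `<=` sector beta)
    (hGamma1 : Gamma1 `<=` frontier Omega `&` frontier (sector beta))
    (c : 'rV[R]_n.+2 -> R) (c0 : R)
    (hc0 : 0 < c0)
    (hc : Lp Omega +oo%E c)
    (hcc0 : ('N[lebesgue_rV R n.+2]_+oo[EFin \o (c^\+%R \_ Omega)] < c0%:E)%E)
    (w : 'rV[R]_n.+2 -> R)
    (hw : weak_mixed_subsolution Omega Gamma1 c w)
    (hthin : Omega `<=` [set x |
       penult_coord x ^+ 2 + last_coord x ^+ 2 < (bessel_j0 / Num.sqrt c0) ^+ 2]) :
  {ae lebesgue_rV R n.+2, forall x, Omega x -> w x <= 0}.
Proof.
have [[p0 Op0] oO _ bO] := hOmega.
have [Ww Hu _] := hw; have [Wu _] := Hu.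
have [C /andP[C0 Cc0] cC] := Lnorm_oo_ae hc0 hcc0.
have energy := energy_le oO bO hc cC hw.
(* any constant strictly between C and c0: above C for the energy inequality,
   below c0 for the ground state to be positive on the closed cylinder *)
pose c1 := (C + c0) / 2.
have c1C : C < c1 by rewrite /c1; lra.
have c1c0 : c1 < c0 by rewrite /c1; lra.
have c1_gt0 : 0 < c1 by apply: le_lt_trans c1C.
pose S : R := bessel_j0 ^+ 2 / c0.
have SE : (bessel_j0 / Num.sqrt c0) ^+ 2 = S by rewrite expr_div_n sqr_sqrtr// ltW.
have S0 : 0 < S by rewrite -SE; apply: le_lt_trans (hthin _ Op0); exact: rad2_ge0.
have cS : c1 * S < bessel_j0 ^+ 2.
  have -> : bessel_j0 ^+ 2 = c0 * S by rewrite /S mulrCA divff ?mulr1// gt_eqF.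
  by rewrite ltr_pM2r.
have OS p : Omega p -> rad2 p <= S by move=> /hthin; rewrite /= SE => /ltW.
have hG : Gamma1 `<=` frontier (sector beta) by move=> x /hGamma1[].
have poincare := poincare_H10 oO bO c1_gt0 Hu (fun phi sphi sG =>
  poincare_test oO bO hsector hG c1_gt0 (ltW S0) cS OS sphi sG).
have u2 := W12_sqint oO Wu.
have u0 := Rintegral_sqr_eq0 oO u2.
have : \int[lebesgue_rV R n.+2]_(x in Omega) (w^\+%R x ^+ 2) <= 0.
  have h := le_trans poincare energy.
  by rewrite -subr_le0 -mulrBl pmulr_rle0 ?subr_gt0 in h.
move=> /u0; apply: filterS => x + Ox => /(_ Ox) <-.
by rewrite /funrpos le_max lexx.
Qed.
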